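(* Let $\Omega\subset\mathbb R^N$ be a bounded domain which, for every $i=1,\dots,N$, is convex in the $x_i$ direction and symmetric with respect to the hyperplane $\{x_i=0\}$. Let $f\in C^1(\mathbb R)$ and let $u\in C^2(\Omega)\cap C(\overline\Omega)$ satisfy $$-\Delta u=f(u)\ \text{in }\Omega,\qquad u>0\ \text{in }\Omega,\qquad u=0\ \text{on }\partial\Omega.$$ Then the Hessian matrix of $u$ at the origin is diagonal and negative definite. *)

(* Defs.v *)
From Stdlib Require Import Reals Lra.
From Stdlib Require Vectors.Fin.
Open Scope R_scope.

Definition pt (N : nat) := Fin.t N -> R.

Definition origin {N : nat} : pt N := fun _ => 0.

Definition upd {N : nat} (x : pt N) (i : Fin.t N) (t : R) : pt N :=
  fun j => if Fin.eq_dec i j then t else x j.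

Fixpoint sumF (N : nat) : (Fin.t N -> R) -> R :=
  match N return (Fin.t N -> R) -> R with
  | O => fun _ => 0
  | S n => fun g => g Fin.F1 + sumF n (fun i => g (Fin.FS i))
  end.

(* y is within distance r of x (sup-norm ball; same topology as Euclidean) *)
Definition near {N : nat} (x y : pt N) (r : R) : Prop :=
  forall i, Rabs (y i - x i) < r.

Definition is_open {N : nat} (A : pt N -> Prop) : Prop :=
  forall x, A x -> exists r, 0 < r /\ forall y, near x y r -> A y.

Definition is_connected {N : nat} (A : pt N -> Prop) : Prop :=
  forall U V : pt N -> Prop, is_open U -> is_open V ->
    (forall x, A x -> U x \/ V x) ->
    (forall x, A x -> U x -> V x -> False) ->
    (exists x, A x /\ U x) -> (exists x, A x /\ V x) -> False.

Definition is_domain {N : nat} (A : pt N -> Prop) : Prop :=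
  (exists x, A x) /\ is_open A /\ is_connected A.

Definition is_bounded {N : nat} (A : pt N -> Prop) : Prop :=
  exists M, forall x, A x -> forall i, Rabs (x i) <= M.

Definition closure {N : nat} (A : pt N -> Prop) (x : pt N) : Prop :=
  forall r, 0 < r -> exists y, A y /\ near x y r.

Definition boundary {N : nat} (A : pt N -> Prop) (x : pt N) : Prop :=
  closure A x /\ ~ A x.

Definition convex_in_dir {N : nat} (A : pt N -> Prop) (i : Fin.t N) : Prop :=
  forall x a b c, A (upd x i a) -> A (upd x i b) -> a <= c <= b -> A (upd x i c).

Definition symmetric_in_dir {N : nat} (A : pt N -> Prop) (i : Fin.t N) : Prop :=
  forall x, A x -> A (upd x i (- x i)).

Definition continuous_on {N : nat} (A : pt N -> Prop) (g : pt N -> R) : Prop :=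
  forall x, A x -> forall eps, 0 < eps ->
    exists delta, 0 < delta /\
      forall y, A y -> near x y delta -> Rabs (g y - g x) < eps.

Definition has_partial {N : nat} (g : pt N -> R) (i : Fin.t N) (x : pt N) (l : R) : Prop :=
  derivable_pt_lim (fun t => g (upd x i t)) (x i) l.

Definition C2_on {N : nat} (A : pt N -> Prop) (g : pt N -> R)
    (D1 : Fin.t N -> pt N -> R) (D2 : Fin.t N -> Fin.t N -> pt N -> R) : Prop :=
  continuous_on A g /\
  (forall j x, A x -> has_partial g j x (D1 j x)) /\
  (forall j, continuous_on A (D1 j)) /\
  (forall i j x, A x -> has_partial (D1 j) i x (D2 i j x)) /\
  (forall i j, continuous_on A (D2 i j)).

Definition C1_R (f : R -> R) : Prop :=
  exists f' : R -> R, (forall t, derivable_pt_lim f t (f' t)) /\ continuity f'.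

(* Main.v *)
(** For [lam >= 0] put [w(x) = u(x^lam) - u(x)] on the cap [{x in Omega : x_i > lam}], where
    [x^lam] is the reflection of [x] in [{x_i = lam}]. The boundary of [Omega] is arbitrary, so
    [w >= 0] is propagated from large [lam] down to [0] as in Berestycki-Nirenberg, with the
    maximum principle in sets of small volume; the latter is a discrete form of the
    Alexandroff-Bakelman-Pucci estimate that only counts dyadic cubes. Strict positivity of [w]
    comes from an explicit barrier on thin tubes along coordinate segments. At [lam = 0] one
    gets the symmetry of [u], hence the vanishing of the mixed derivatives at the origin.

    Since [u] is only [C^2], Hopf's lemma cannot be applied to [D_i u]. Instead the tube
    barrier bounds [w] from below by [kappa lam (x_i - lam)] on the [x_i] axis with [kappa]
    independent of [lam], which gives [D_i u <= - kappa lam / 2] at [lam e_i], and so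
    [D_ii u(0) <= - kappa / 2]. The starting point is a point of the axis where
    [D_i u < 0]; it exists because [u(0) > 0] and [u] vanishes at the end of the axis. *)

From Coquelicot Require Import Coquelicot.
From Stdlib Require Import Reals Lra Lia List Classical ClassicalEpsilon FunctionalExtensionality.
From Stdlib Require Vectors.Fin.
Require Import Defs.
Open Scope R_scope.

(** * Points, sums over coordinates, compactness *)

(** Subtracting the equations at [x^lam] and [x] gives a linear inequality for [w] whose
    zeroth-order coefficient is bounded by a Lipschitz constant [C] of [f] but has no sign. Once
    [w >= 0] is known, [Delta w <= C w] has the sign needed for comparison with a subsolution, in
    tubes of any size.

    Convexity and symmetry enter through one property: a point whose coordinates are dominated in
    absolute value by those of a point of [Omega] lies in [Omega]. It gives the reflected caps, the
    axis, and paths made of coordinate segments inside each cap.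

    The factor [lam] in [kappa lam (x_i - lam)] comes from the symmetry of [u]: at height [xi] on
    the axis, [w = u(2 lam - xi) - u(xi) = u(xi - 2 lam) - u(xi)], an increment of [u] over an
    interval of length [2 lam] near a point where [D_i u < 0]. The rate of the tube barrier depends
    only on the dimension, [C] and the radius, so [kappa] survives the limit [lam -> 0]. *)

Lemma upd_same {N} (x : pt N) i t : upd x i t i = t.
Proof. unfold upd. destruct (Fin.eq_dec i i); congruence. Qed.

Lemma upd_other {N} (x : pt N) i j t : i <> j -> upd x i t j = x j.
Proof. intros H. unfold upd. destruct (Fin.eq_dec i j); congruence. Qed.

Lemma upd_upd {N} (x : pt N) i s t : upd (upd x i s) i t = upd x i t.
Proof.
  apply functional_extensionality. intros j. unfold upd.
  destruct (Fin.eq_dec i j); reflexivity.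
Qed.

Lemma upd_id {N} (x : pt N) i : upd x i (x i) = x.
Proof.
  apply functional_extensionality. intros j. unfold upd.
  destruct (Fin.eq_dec i j); subst; reflexivity.
Qed.

Lemma upd_comm {N} (x : pt N) i j s t :
  i <> j -> upd (upd x i s) j t = upd (upd x j t) i s.
Proof.
  intros H. apply functional_extensionality. intros k. unfold upd.
  destruct (Fin.eq_dec j k), (Fin.eq_dec i k); congruence.
Qed.

Lemma Rabs_le_bounds a b : Rabs a <= b -> - b <= a <= b.
Proof. intros H. pose proof (Rle_abs a). pose proof (Rle_abs (- a)). rewrite Rabs_Ropp in *. lra. Qed.

Lemma near_refl {N} (x : pt N) r : 0 < r -> near x x r.
Proof. intros H i. rewrite Rminus_diag, Rabs_R0. exact H. Qed.

Lemma near_trans {N} (x y z : pt N) r s : near x y r -> near y z s -> near x z (r + s).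
Proof.
  intros H1 H2 i. specialize (H1 i). specialize (H2 i).
  replace (z i - x i) with ((y i - x i) + (z i - y i)) by ring.
  eapply Rle_lt_trans; [apply Rabs_triang | lra].
Qed.

Lemma near_le {N} (x y : pt N) r s : near x y r -> r <= s -> near x y s.
Proof. intros H Hs i. specialize (H i). lra. Qed.

Lemma near_upd {N} (x y : pt N) i a b r :
  near x y r -> Rabs (b - a) < r -> near (upd x i a) (upd y i b) r.
Proof.
  intros H Hab j. unfold upd. destruct (Fin.eq_dec i j); auto.
Qed.

Lemma near_upd_self {N} (x : pt N) i t r :
  Rabs (t - x i) < r -> near x (upd x i t) r.
Proof.
  intros H. rewrite <- (upd_id x i) at 1. apply near_upd; auto.
  apply near_refl. eapply Rle_lt_trans; [apply Rabs_pos | exact H].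
Qed.

Definition consp {N} (a : R) (v : pt N) : pt (S N) :=
  fun i => Fin.caseS' i (fun _ => R) a v.

Lemma consp_eta {N} (x : pt (S N)) : consp (x Fin.F1) (fun i => x (Fin.FS i)) = x.
Proof.
  apply functional_extensionality. intros i. unfold consp.
  apply (Fin.caseS' i); reflexivity.
Qed.

Lemma upd_consp_FS {N} a (v : pt N) j t : upd (consp a v) (Fin.FS j) t = consp a (upd v j t).
Proof.
  apply functional_extensionality. intros k. apply (Fin.caseS' k).
  - unfold upd. destruct (Fin.eq_dec (Fin.FS j) Fin.F1); [discriminate | reflexivity].
  - intros k'. unfold upd. cbn [consp Fin.caseS'].
    destruct (Fin.eq_dec j k') as [->|E].
    + destruct (Fin.eq_dec (Fin.FS k') (Fin.FS k')); congruence.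
    + destruct (Fin.eq_dec (Fin.FS j) (Fin.FS k')) as [E'|]; [|reflexivity].
      apply Fin.FS_inj in E'. congruence.
Qed.

Lemma upd_consp_F1 {N} a (v : pt N) t : upd (consp a v) Fin.F1 t = consp t v.
Proof.
  apply functional_extensionality. intros k. apply (Fin.caseS' k).
  - apply upd_same.
  - intros k'. rewrite upd_other by discriminate. reflexivity.
Qed.

(** The coordinates of [x] are turned into those of [y] one by one, by induction on the dimension
    with the tail treated before the head. The step also learns that each coordinate of [z] comes
    from [x] or from [y], which later locates the intermediate points. *)
Lemma coordinatewise_ind {N} (Q : pt N -> Prop) (x y : pt N) :
  Q x ->
  (forall z j, Q z -> (forall k, z k = x k \/ z k = y k) -> Q (upd z j (y j))) ->
  Q y.
Proof.
  induction N as [|n IH]; intros Hx Hstep.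
  - replace y with x; auto. apply functional_extensionality. intros i. apply (Fin.case0 (fun _ => _) i).
  - assert (H : Q (consp (x Fin.F1) (fun i => y (Fin.FS i)))).
    { apply (IH (fun v => Q (consp (x Fin.F1) v)) (fun i => x (Fin.FS i))).
      - rewrite consp_eta. exact Hx.
      - intros z j Hz Hk. rewrite <- upd_consp_FS. apply (Hstep _ (Fin.FS j)); auto.
        intros k. apply (Fin.caseS' k); [left; reflexivity | exact Hk]. }
    apply (Hstep _ Fin.F1) in H.
    + rewrite upd_consp_F1, consp_eta in H. exact H.
    + intros k. apply (Fin.caseS' k); [left | right]; reflexivity.
Qed.

Lemma sumF_ext N (a b : Fin.t N -> R) : (forall i, a i = b i) -> sumF N a = sumF N b.
Proof. intros H. f_equal. apply functional_extensionality. exact H. Qed.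

Lemma sumF_le N (a b : Fin.t N -> R) : (forall i, a i <= b i) -> sumF N a <= sumF N b.
Proof.
  induction N; intros H; simpl; [lra|].
  apply Rplus_le_compat; [apply H | apply IHN; intros; apply H].
Qed.

Lemma sumF_lin N c (a b : Fin.t N -> R) :
  sumF N (fun i => a i + c * b i) = sumF N a + c * sumF N b.
Proof. induction N; simpl; [|rewrite IHN]; ring. Qed.

Lemma sumF_const N c : sumF N (fun _ => c) = INR N * c.
Proof.
  induction N; [simpl; ring|]. rewrite S_INR. simpl sumF. rewrite IHN. ring.
Qed.

Lemma sumF_scal N c (a : Fin.t N -> R) : sumF N (fun i => c * a i) = c * sumF N a.
Proof.
  rewrite (sumF_ext N _ (fun i => (fun _ => 0) i + c * a i)) by (intros; ring).
  rewrite sumF_lin, sumF_const. ring.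
Qed.

Lemma sumF_0 N (a : Fin.t N -> R) : (forall i, a i = 0) -> sumF N a = 0.
Proof.
  intros H. rewrite (sumF_ext N a (fun _ => 0)) by exact H. rewrite sumF_const. ring.
Qed.

Lemma sumF_nonneg N (a : Fin.t N -> R) : (forall i, 0 <= a i) -> 0 <= sumF N a.
Proof. intros H. rewrite <- (sumF_0 N (fun _ => 0)) by auto. apply sumF_le. exact H. Qed.

(** [F] may depend on the index so that squared distances, dot products and weighted sums are all
    covered. *)
Lemma sumF_replace N (F : Fin.t N -> R -> R) (x : pt N) k t :
  sumF N (fun l => F l (upd x k t l)) = sumF N (fun l => F l (x l)) - F k (x k) + F k t.
Proof.
  induction N as [|n IH]; [apply (Fin.case0 (fun _ => _) k)|].
  simpl. revert k. intros k. apply (Fin.caseS' k).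
  - rewrite upd_same.
    rewrite (sumF_ext n _ (fun l => F (Fin.FS l) (x (Fin.FS l)))); [ring|].
    intros l. rewrite upd_other; [reflexivity | discriminate].
  - intros k'. rewrite (upd_other x (Fin.FS k') Fin.F1) by discriminate.
    pose proof (IH (fun l => F (Fin.FS l)) (fun l => x (Fin.FS l)) k') as E.
    cbn beta in E.
    rewrite (sumF_ext n _ (fun l => F (Fin.FS l) (upd (fun l => x (Fin.FS l)) k' t l))).
    + rewrite E. ring.
    + intros l. f_equal. rewrite <- (consp_eta x) at 1. rewrite upd_consp_FS. reflexivity.
Qed.

(** All weights start at 1 and [sumF_replace] sets the one at [k] to 0. *)
Lemma sumF_split N (a : Fin.t N -> R) k :
  sumF N a = a k + sumF N (fun l => if Fin.eq_dec k l then 0 else a l).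
Proof.
  pose proof (sumF_replace N (fun l b => b * a l) (fun _ => 1) k 0) as E.
  cbn beta in E.
  rewrite (sumF_ext N (fun l => 1 * a l) a) in E by (intros; ring).
  rewrite (sumF_ext N (fun l => if Fin.eq_dec k l then 0 else a l)
    (fun l => upd (fun _ => 1) k 0 l * a l)); [lra|].
  intros l. unfold upd. destruct (Fin.eq_dec k l); ring.
Qed.

Lemma sumF_ge_term N (a : Fin.t N -> R) k : (forall i, 0 <= a i) -> a k <= sumF N a.
Proof.
  intros H. rewrite (sumF_split N a k).
  assert (0 <= sumF N (fun l => if Fin.eq_dec k l then 0 else a l)); [|lra].
  apply sumF_nonneg. intros l. destruct (Fin.eq_dec k l); auto. lra.
Qed.

Lemma sumF_only N (a : Fin.t N -> R) k : (forall l, k <> l -> a l = 0) -> sumF N a = a k.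
Proof.
  intros H. rewrite (sumF_split N a k), sumF_0; [ring|].
  intros l. destruct (Fin.eq_dec k l); auto.
Qed.

Lemma Rabs_sumF N (a : Fin.t N -> R) : Rabs (sumF N a) <= sumF N (fun i => Rabs (a i)).
Proof.
  induction N; simpl; [rewrite Rabs_R0; lra|].
  eapply Rle_trans; [apply Rabs_triang|]. apply Rplus_le_compat_l, IHN.
Qed.

Lemma argmax_F N (a : Fin.t N -> R) (i0 : Fin.t N) : exists k, forall j, a j <= a k.
Proof.
  revert i0. induction N as [|n IH]; intros i0; [apply (Fin.case0 (fun _ => _) i0)|].
  destruct n as [|m].
  - exists Fin.F1. intros j. apply (Fin.caseS' j); [apply Rle_refl|].
    intros q. apply (Fin.case0 (fun _ => _) q).
  - destruct (IH (fun l => a (Fin.FS l)) Fin.F1) as [k Hk].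
    destruct (Rle_lt_dec (a Fin.F1) (a (Fin.FS k))) as [H|H].
    + exists (Fin.FS k). intros j. apply (Fin.caseS' j); auto.
    + exists Fin.F1. intros j. apply (Fin.caseS' j); [apply Rle_refl|].
      intros q. apply Rlt_le. eapply Rle_lt_trans; [apply Hk | exact H].
Qed.

Lemma inv_INR_S_pos n : 0 < / (INR n + 1).
Proof. apply Rinv_0_lt_compat. pose proof (pos_INR n). lra. Qed.

Lemma inv_INR_S_small eps : 0 < eps -> exists n0, forall n, (n0 <= n)%nat -> / (INR n + 1) < eps.
Proof.
  intros He. destruct (INR_archimed eps 1 He) as [n0 H]. exists n0. intros n Hn.
  apply le_INR in Hn. pose proof (pos_INR n0).
  apply (Rmult_lt_reg_l (INR n + 1)); [lra|]. rewrite Rinv_r by lra. nra.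
Qed.

(** Instead of being increasing, [phi] satisfies [n <= phi n]; this is stable under composition and
    sends tails into tails, which is enough for limits. *)
Lemma subsequence_convergent (a : nat -> R) M :
  (forall n, Rabs (a n) <= M) ->
  exists phi l, (forall n, (n <= phi n)%nat) /\ Un_cv (fun n => a (phi n)) l.
Proof.
  intros HM.
  destruct (Bolzano_Weierstrass a (fun c => - M <= c <= M)) as [l Hl].
  - apply compact_P3.
  - intros n. specialize (HM n). unfold Rabs in HM. destruct (Rcase_abs (a n)); lra.
  - assert (H : forall n : nat, exists p, (n <= p)%nat /\ Rabs (a p - l) < / (INR n + 1)).
    { intros n. destruct (Hl (disc l (mkposreal _ (inv_INR_S_pos n))) n) as [p [Hp Hd]].
      - exists (mkposreal _ (inv_INR_S_pos n)). intros y Hy; exact Hy.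
      - exists p. split; auto. }
    destruct (choice _ H) as [phi Hphi].
    exists phi, l. split; [intros n; apply Hphi|].
    intros eps He. destruct (inv_INR_S_small eps He) as [n0 Hn0]. exists n0. intros n Hn.
    unfold Rdist. specialize (Hn0 n Hn). destruct (Hphi n). lra.
Qed.

Lemma bounded_seq_subsequence N (X : nat -> pt N) M :
  (forall n i, Rabs (X n i) <= M) ->
  exists phi x, (forall n, (n <= phi n)%nat) /\ forall i, Un_cv (fun n => X (phi n) i) (x i).
Proof.
  revert X.
  induction N as [|k IH]; intros X HM.
  - exists (fun n => n), (fun _ => 0). split; [auto|]. intros i. apply (Fin.case0 (fun _ => _) i).
  - destruct (subsequence_convergent (fun n => X n Fin.F1) M) as [p1 [l [H1 H2]]]; [intros; apply HM|].
    destruct (IH (fun n i => X (p1 n) (Fin.FS i))) as [p2 [x [H3 H4]]]; [intros; apply HM|].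
    exists (fun n => p1 (p2 n)), (consp l x). split.
    + intros n. specialize (H3 n). specialize (H1 (p2 n)). lia.
    + intros i. apply (Fin.caseS' i); [|exact H4].
      cbn [consp Fin.caseS']. intros eps He. destruct (H2 eps He) as [n0 Hn0]. exists n0. intros n Hn. apply Hn0.
      specialize (H3 n). lia.
Qed.

Definition is_closed {N} (A : pt N -> Prop) := forall x, closure A x -> A x.

Lemma cluster_point {N} (A : pt N -> Prop) (X : nat -> pt N) :
  is_bounded A -> is_closed A -> (forall n, A (X n)) ->
  exists x, A x /\ forall r n0, 0 < r -> exists n, (n0 <= n)%nat /\ near x (X n) r.
Proof.
  intros [M HM] Hc HX.
  destruct (bounded_seq_subsequence N X M) as [phi [x [Hphi Hx]]]; [intros; apply HM; auto|].
  assert (H : forall r n0, 0 < r -> exists n, (n0 <= n)%nat /\ near x (X n) r).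
  { intros r n0 Hr.
    assert (E : exists n1, forall n, (n1 <= n)%nat -> near x (X (phi n)) r).
    { destruct (choice (fun i n1 => forall n, (n1 <= n)%nat -> Rdist (X (phi n) i) (x i) < r)) as [F HF].
      { intros i. destruct (Hx i r Hr) as [n1 H1]. exists n1. exact H1. }
      assert (Hb : forall m (G : Fin.t m -> nat), exists b, forall i, (G i <= b)%nat).
      { induction m; intros G.
        - exists 0%nat. intros i. apply (Fin.case0 (fun _ => _) i).
        - destruct (IHm (fun i => G (Fin.FS i))) as [b Hb]. exists (b + G Fin.F1)%nat.
          intros i. apply (Fin.caseS' i); [lia|]. intros j. specialize (Hb j). lia. }
      destruct (Hb _ F) as [b Hb']. exists b. intros n Hn i. apply HF. specialize (Hb' i). lia. }
    destruct E as [n1 E]. exists (phi (n0 + n1)%nat). split.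
    - specialize (Hphi (n0 + n1)%nat). lia.
    - apply E. lia. }
  exists x. split; [|exact H]. apply Hc. intros r Hr. destruct (H r 0%nat Hr) as [n [_ Hn]].
  exists (X n). auto.
Qed.

(** Compactness in the form used for proofs by contradiction: if a uniform estimate fails for every
    [n], the failures accumulate at a point of [A], where the local estimate is then
    contradicted. *)
Lemma cluster_choice {N} (A : pt N -> Prop) (Q : nat -> pt N -> Prop) :
  is_bounded A -> is_closed A -> (forall n, exists x, A x /\ Q n x) ->
  exists x, A x /\ forall r n0, 0 < r -> exists n y, (n0 <= n)%nat /\ near x y r /\ A y /\ Q n y.
Proof.
  intros Hb Hc H. destruct (choice (fun n x => A x /\ Q n x) H) as [X HX].
  destruct (cluster_point A X Hb Hc) as [x [Hx Hcl]]; [intros; apply HX|].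
  exists x. split; auto. intros r n0 Hr. destruct (Hcl r n0 Hr) as [n [Hn Hnear]].
  exists n, (X n). destruct (HX n). auto.
Qed.

Lemma continuous_attains_min {N} (A : pt N -> Prop) (g : pt N -> R) :
  is_bounded A -> is_closed A -> continuous_on A g -> (exists x, A x) ->
  exists x, A x /\ forall y, A y -> g x <= g y.
Proof.
  intros Hb Hc Hg [x0 Hx0].
  assert (HB : exists m, forall x, A x -> m <= g x).
  { apply NNPP. intros HN.
    destruct (cluster_choice A (fun n x => g x < - INR n)) as [x [Hx Hcl]]; auto.
    { intros n. apply NNPP. intros HN2. apply HN. exists (- INR n). intros x Hx.
      apply Rnot_lt_le. intros Hlt. apply HN2. exists x; auto. }
    destruct (Hg x Hx 1 Rlt_0_1) as [d [Hd Hcont]].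
    destruct (INR_unbounded (1 - g x)) as [n0 Hn0].
    destruct (Hcl d n0 Hd) as [n [y [Hn [Hnear [Hy Hlt]]]]].
    specialize (Hcont y Hy Hnear). apply le_INR in Hn.
    apply Rabs_def2 in Hcont. lra. }
  destruct HB as [m Hm].
  destruct (completeness (fun v => exists x, A x /\ v = - g x)) as [L [HL1 HL2]].
  { exists (- m). intros v [x [Hx ->]]. specialize (Hm x Hx). lra. }
  { exists (- g x0). exists x0; auto. }
  destruct (cluster_choice A (fun n x => g x < - L + / (INR n + 1))) as [x [Hx Hcl]]; auto.
  { intros n. apply NNPP. intros HN. pose proof (inv_INR_S_pos n).
    assert (L <= L - / (INR n + 1)); [|lra].
    apply HL2. intros v [x [Hx ->]]. apply Rnot_lt_le. intros Hlt. apply HN. exists x. split; auto. lra. }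
  exists x. split; auto. intros y Hy.
  assert (Hy' : - L <= g y). { assert (- g y <= L); [|lra]. apply HL1. exists y; auto. }
  enough (g x <= - L) by lra.
  apply Rnot_lt_le. intros Hlt.
  destruct (Hg x Hx ((g x + L) / 2)) as [d [Hd Hcont]]; [lra|].
  destruct (inv_INR_S_small ((g x + L) / 2)) as [n0 Hn0]; [lra|].
  destruct (Hcl d n0 Hd) as [n [z [Hn [Hnear [Hz Hlt2]]]]].
  specialize (Hcont z Hz Hnear). specialize (Hn0 n Hn). apply Rabs_def2 in Hcont. lra.
Qed.

Lemma closure_incl {N} (A : pt N -> Prop) x : A x -> closure A x.
Proof. intros H r Hr. exists x. split; auto. apply near_refl; auto. Qed.

Lemma closure_closed {N} (A : pt N -> Prop) : is_closed (closure A).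
Proof.
  intros x H r Hr. destruct (H (r / 2)) as [y [Hy Hxy]]; [lra|].
  destruct (Hy (r / 2)) as [z [Hz Hyz]]; [lra|].
  exists z. split; auto. replace r with (r / 2 + r / 2) by field. eapply near_trans; eauto.
Qed.

Lemma closure_mono {N} (A B : pt N -> Prop) x :
  (forall y, A y -> B y) -> closure A x -> closure B x.
Proof. intros H Hx r Hr. destruct (Hx r Hr) as [y [Hy Hn]]. exists y; auto. Qed.

Lemma closure_bounded_coord {N} (A : pt N -> Prop) i c x :
  (forall y, A y -> y i <= c) -> closure A x -> x i <= c.
Proof.
  intros H Hx. apply Rnot_lt_le. intros Hlt.
  destruct (Hx (x i - c)) as [y [Hy Hn]]; [lra|].
  specialize (H y Hy). specialize (Hn i). apply Rabs_def2 in Hn. lra.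
Qed.

Lemma closure_bounded_coord_below {N} (A : pt N -> Prop) i c x :
  (forall y, A y -> c <= y i) -> closure A x -> c <= x i.
Proof.
  intros H Hx. apply Rnot_lt_le. intros Hlt.
  destruct (Hx (c - x i)) as [y [Hy Hn]]; [lra|].
  specialize (H y Hy). specialize (Hn i). apply Rabs_def2 in Hn. lra.
Qed.

Lemma closure_bounded {N} (A : pt N -> Prop) M :
  (forall x, A x -> forall i, Rabs (x i) <= M) -> forall x, closure A x -> forall i, Rabs (x i) <= M.
Proof.
  intros H x Hx i.
  apply Rabs_le. split.
  - apply (closure_bounded_coord_below A i); auto. intros y Hy. specialize (H y Hy i).
    apply Rabs_le_bounds in H. lra.
  - apply (closure_bounded_coord A i); auto. intros y Hy. specialize (H y Hy i).
    apply Rabs_le_bounds in H. lra.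
Qed.

(** * Minima and the tube barrier *)

Lemma continuous_on_subset {N} (A B : pt N -> Prop) g :
  (forall x, A x -> B x) -> continuous_on B g -> continuous_on A g.
Proof.
  intros H Hg x Hx eps He. destruct (Hg x (H x Hx) eps He) as [d [Hd Hc]].
  exists d. split; auto.
Qed.

Lemma continuous_on_const {N} (A : pt N -> Prop) c : continuous_on A (fun _ => c).
Proof.
  intros x _ eps He. exists 1. split; [lra|]. intros. rewrite Rminus_diag, Rabs_R0. exact He.
Qed.

Lemma continuous_on_coord {N} (A : pt N -> Prop) i : continuous_on A (fun x => x i).
Proof. intros x _ eps He. exists eps. split; auto. Qed.

Lemma continuous_on_comp {N} (A : pt N -> Prop) g (phi : R -> R) :
  continuous_on A g -> (forall x, A x -> continuity_pt phi (g x)) ->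
  continuous_on A (fun x => phi (g x)).
Proof.
  intros Hg Hphi x Hx eps He.
  destruct (Hphi x Hx eps He) as [a [Ha H1]].
  destruct (Hg x Hx a Ha) as [d [Hd H2]]. exists d. split; auto.
  intros y Hy Hn. destruct (Req_dec (g y) (g x)) as [E|E].
  - rewrite E, Rminus_diag, Rabs_R0. exact He.
  - apply (H1 (g y)). split; [split; [exact I | auto]|]. apply H2; auto.
Qed.

Lemma continuous_on_plus {N} (A : pt N -> Prop) g h :
  continuous_on A g -> continuous_on A h -> continuous_on A (fun x => g x + h x).
Proof.
  intros Hg Hh x Hx eps He.
  destruct (Hg x Hx (eps / 2)) as [d1 [Hd1 H1]]; [lra|].
  destruct (Hh x Hx (eps / 2)) as [d2 [Hd2 H2]]; [lra|].
  exists (Rmin d1 d2). split; [apply Rmin_pos; auto|].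
  intros y Hy Hn.
  specialize (H1 y Hy (near_le _ _ _ _ Hn (Rmin_l _ _))).
  specialize (H2 y Hy (near_le _ _ _ _ Hn (Rmin_r _ _))).
  apply Rabs_def2 in H1. apply Rabs_def2 in H2. apply Rabs_def1; lra.
Qed.

Lemma continuous_on_scal {N} (A : pt N -> Prop) c g :
  continuous_on A g -> continuous_on A (fun x => c * g x).
Proof.
  intros Hg. apply (continuous_on_comp A g (fun v => c * v)); auto.
  intros x _. apply derivable_continuous_pt. reg.
Qed.

Lemma continuous_on_minus {N} (A : pt N -> Prop) g h :
  continuous_on A g -> continuous_on A h -> continuous_on A (fun x => g x - h x).
Proof.
  intros Hg Hh x Hx eps He.
  destruct (continuous_on_plus A g (fun x => -1 * h x) Hg (continuous_on_scal A (-1) h Hh) x Hx eps He)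
    as [d [Hd H]].
  exists d. split; auto. intros y Hy Hn. specialize (H y Hy Hn).
  replace (g y - h y - (g x - h x)) with (g y + -1 * h y - (g x + -1 * h x)) by ring. exact H.
Qed.

(** Polarisation, [g h = ((g + h)^2 - (g - h)^2) / 4], reduces products to sums and composition with
    the square. *)
Lemma continuous_on_mult {N} (A : pt N -> Prop) g h :
  continuous_on A g -> continuous_on A h -> continuous_on A (fun x => g x * h x).
Proof.
  intros Hg Hh.
  assert (Hsq : forall v, continuous_on A v -> continuous_on A (fun x => (v x)^2)).
  { intros v Hv. apply (continuous_on_comp A v (fun b => b^2)); auto.
    intros x _. apply derivable_continuous_pt. reg. }
  pose proof (continuous_on_scal A (/4) _ (continuous_on_minus A _ _
    (Hsq _ (continuous_on_plus A g h Hg Hh)) (Hsq _ (continuous_on_minus A g h Hg Hh)))) as H.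
  intros x Hx eps He. destruct (H x Hx eps He) as [d [Hd Hc]]. exists d. split; auto.
  intros y Hy Hn. specialize (Hc y Hy Hn).
  match goal with |- Rabs ?a < _ => match type of Hc with Rabs ?b < _ => replace a with b by field end end.
  exact Hc.
Qed.

Lemma continuous_on_sumF {N} (A : pt N -> Prop) M (g : Fin.t M -> pt N -> R) :
  (forall i, continuous_on A (g i)) -> continuous_on A (fun x => sumF M (fun i => g i x)).
Proof.
  induction M; intros H; simpl; [apply continuous_on_const|].
  apply continuous_on_plus; auto.
Qed.

(** The one-sided form also serves at the very end, where lower bounds are known only to the right
    of 0. *)
Lemma derivative_at_right_min_nonneg g t0 l d :
  derivable_pt_lim g t0 l -> 0 < d -> (forall s, 0 < s < d -> g t0 <= g (t0 + s)) -> 0 <= l.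
Proof.
  intros Hg Hd Hmin. apply Rnot_lt_le. intros Hl.
  destruct (Hg (- l / 2)) as [e He]; [lra|]. pose proof (cond_pos e).
  set (s := Rmin d e / 2).
  assert (0 < Rmin d e) by (apply Rmin_pos; auto).
  pose proof (Rmin_l d e). pose proof (Rmin_r d e).
  assert (Hs : 0 < s) by (unfold s; lra).
  specialize (He s). rewrite (Rabs_right s) in He by lra.
  assert (Hq : Rabs ((g (t0 + s) - g t0) / s - l) < - l / 2) by (apply He; unfold s; lra).
  apply Rabs_def2 in Hq.
  assert (0 <= (g (t0 + s) - g t0) / s); [|lra].
  apply Rdiv_le_0_compat; auto. specialize (Hmin s). unfold s in *; lra.
Qed.

Lemma derivative_at_min g t0 l d :
  derivable_pt_lim g t0 l -> 0 < d -> (forall s, Rabs s < d -> g t0 <= g (t0 + s)) -> l = 0.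
Proof.
  intros Hg Hd Hmin.
  assert (0 <= l).
  { apply (derivative_at_right_min_nonneg g t0 l d); auto.
    intros s Hs. apply Hmin. rewrite Rabs_right; lra. }
  assert (0 <= - l); [|lra].
  (* Reversing the line around [t0] turns the left side into the right one. *)
  apply (derivative_at_right_min_nonneg (fun t => g (2 * t0 - t)) t0 (- l) d); auto.
  - replace (- l) with (l * (0 - 1)) by ring.
    apply (derivable_pt_lim_comp (fun t => 2 * t0 - t) g).
    + apply (derivable_pt_lim_minus (fun _ => 2 * t0) (fun t => t)).
      * apply derivable_pt_lim_const.
      * apply derivable_pt_lim_id.
    + replace (2 * t0 - t0) with t0 by ring. exact Hg.
  - intros s Hs. replace (2 * t0 - t0) with t0 by ring.
    replace (2 * t0 - (t0 + s)) with (t0 + - s) by ring.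
    apply Hmin. rewrite Rabs_Ropp, Rabs_right; lra.
Qed.

(** If [l < 0] then [g1], which vanishes at [t0], is negative just to the right of [t0], and the
    mean value theorem puts [g] below [g t0] there. *)
Lemma second_derivative_at_min g g1 t0 l d :
  0 < d -> (forall s, Rabs s < d -> derivable_pt_lim g (t0 + s) (g1 (t0 + s))) ->
  derivable_pt_lim g1 t0 l -> (forall s, Rabs s < d -> g t0 <= g (t0 + s)) ->
  g1 t0 = 0 /\ 0 <= l.
Proof.
  intros Hd Hg Hg1 Hmin.
  assert (E : g1 t0 = 0).
  { apply (derivative_at_min g t0 _ d); auto.
    specialize (Hg 0). rewrite Rplus_0_r in Hg. apply Hg. rewrite Rabs_R0. exact Hd. }
  split; auto. apply Rnot_lt_le. intros Hl.
  destruct (Hg1 (- l / 2)) as [e He]; [lra|]. pose proof (cond_pos e).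
  set (s := Rmin d e / 2).
  assert (0 < Rmin d e) by (apply Rmin_pos; auto).
  pose proof (Rmin_l d e). pose proof (Rmin_r d e).
  assert (Hs : 0 < s) by (unfold s; lra).
  destruct (MVT_cor2 g g1 t0 (t0 + s)) as [c [Hc1 Hc2]]; [lra| |].
  { intros c Hc. replace c with (t0 + (c - t0)) by ring. apply Hg.
    rewrite Rabs_right; unfold s in *; lra. }
  assert (Hmin' : g t0 <= g (t0 + s)).
  { apply Hmin. rewrite Rabs_right; unfold s; lra. }
  specialize (He (c - t0)). rewrite (Rabs_right (c - t0)) in He by lra.
  replace (t0 + (c - t0)) with c in He by ring. rewrite E in He.
  assert (Hq : Rabs ((g1 c - 0) / (c - t0) - l) < - l / 2) by (apply He; unfold s in *; lra).
  apply Rabs_def2 in Hq.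
  assert (Hneg : g1 c < 0).
  { replace (g1 c) with ((g1 c - 0) / (c - t0) * (c - t0)) by (field; lra). nra. }
  nra.
Qed.

Lemma has_partial_line {N} (g : pt N -> R) k (x : pt N) t l :
  has_partial g k (upd x k t) l <-> derivable_pt_lim (fun s => g (upd x k s)) t l.
Proof.
  unfold has_partial. rewrite upd_same.
  replace (fun s => g (upd (upd x k t) k s)) with (fun s => g (upd x k s)); [reflexivity|].
  apply functional_extensionality. intros s. rewrite upd_upd. reflexivity.
Qed.

(** The Laplacian and the tests at a minimum see only derivatives along coordinate lines. Carrying
    [G1] and [G2] as functions lets those of barriers and reflections be written explicitly. *)
Definition pure_C2 {N} (A : pt N -> Prop) (g : pt N -> R) (G1 G2 : Fin.t N -> pt N -> R) :=
  (forall k x, A x -> has_partial g k x (G1 k x)) /\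
  (forall k x, A x -> has_partial (G1 k) k x (G2 k x)).

Lemma pure_C2_subset {N} (A B : pt N -> Prop) g G1 G2 :
  (forall x, A x -> B x) -> pure_C2 B g G1 G2 -> pure_C2 A g G1 G2.
Proof. intros H [H1 H2]. split; auto. Qed.

Lemma pure_C2_lin {N} (A : pt N -> Prop) c g G1 G2 h H1 H2 :
  pure_C2 A g G1 G2 -> pure_C2 A h H1 H2 ->
  pure_C2 A (fun x => g x - c * h x) (fun k x => G1 k x - c * H1 k x) (fun k x => G2 k x - c * H2 k x).
Proof.
  intros [Hg1 Hg2] [Hh1 Hh2]. split; intros k x Hx.
  - apply (derivable_pt_lim_minus (fun t => g (upd x k t)) (fun t => c * h (upd x k t))).
    + apply Hg1; auto.
    + apply (derivable_pt_lim_scal (fun t => h (upd x k t))). apply Hh1; auto.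
  - apply (derivable_pt_lim_minus (fun t => G1 k (upd x k t)) (fun t => c * H1 k (upd x k t))).
    + apply Hg2; auto.
    + apply (derivable_pt_lim_scal (fun t => H1 k (upd x k t))). apply Hh2; auto.
Qed.

Lemma pure_C2_at_min {N} (A : pt N -> Prop) g G1 G2 x r :
  pure_C2 A g G1 G2 -> 0 < r -> (forall y, near x y r -> A y /\ g x <= g y) ->
  forall k, G1 k x = 0 /\ 0 <= G2 k x.
Proof.
  intros [H1 H2] Hr Hmin k.
  destruct (second_derivative_at_min (fun t => g (upd x k t)) (fun t => G1 k (upd x k t)) (x k) (G2 k x) r)
    as [Ea Eb]; auto.
  - intros s Hs. apply has_partial_line. apply H1. apply Hmin. apply near_upd_self.
    replace (x k + s - x k) with s by ring. exact Hs.
  - apply H2. apply Hmin. apply near_refl; auto.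
  - intros s Hs. rewrite upd_id. apply Hmin. apply near_upd_self.
    replace (x k + s - x k) with s by ring. exact Hs.
  - rewrite upd_id in Ea. auto.
Qed.

(** Squared distance from [x] to the line through [y] parallel to the [j] axis. *)
Definition dist2_off {N} (y : pt N) (j : Fin.t N) (x : pt N) : R :=
  sumF N (fun k => if Fin.eq_dec j k then 0 else (x k - y k)^2).

Lemma dist2_off_upd_other {N} (y : pt N) j x k t :
  j <> k -> dist2_off y j (upd x k t) = dist2_off y j x - (x k - y k)^2 + (t - y k)^2.
Proof.
  intros H. unfold dist2_off.
  rewrite (sumF_replace N (fun l b => if Fin.eq_dec j l then 0 else (b - y l)^2)).
  destruct (Fin.eq_dec j k); [contradiction | reflexivity].
Qed.

Lemma dist2_off_upd_same {N} (y : pt N) j x t : dist2_off y j (upd x j t) = dist2_off y j x.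
Proof.
  unfold dist2_off. apply sumF_ext. intros k. destruct (Fin.eq_dec j k); auto.
  rewrite upd_other; auto.
Qed.

Lemma dist2_off_self {N} (y : pt N) j t : dist2_off y j (upd y j t) = 0.
Proof.
  unfold dist2_off. apply sumF_0. intros k. destruct (Fin.eq_dec j k); auto.
  rewrite upd_other by auto. ring.
Qed.

Lemma dist2_off_nonneg {N} (y : pt N) j x : 0 <= dist2_off y j x.
Proof.
  apply sumF_nonneg. intros k. destruct (Fin.eq_dec j k); [lra | apply pow2_ge_0].
Qed.

Lemma dist2_off_ge {N} (y : pt N) j x k : j <> k -> (x k - y k)^2 <= dist2_off y j x.
Proof.
  intros H.
  pose proof (sumF_ge_term N (fun k => if Fin.eq_dec j k then 0 else (x k - y k)^2) k) as E.
  cbn beta in E. destruct (Fin.eq_dec j k); [contradiction|]. apply E.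
  intros i. destruct (Fin.eq_dec j i); [lra | apply pow2_ge_0].
Qed.

Lemma dist2_off_continuous {N} (A : pt N -> Prop) y j : continuous_on A (dist2_off y j).
Proof.
  apply (continuous_on_sumF A N (fun k x => if Fin.eq_dec j k then 0 else (x k - y k)^2)).
  intros k. destruct (Fin.eq_dec j k); [apply continuous_on_const|].
  apply (continuous_on_comp A (fun x => x k) (fun b => (b - y k)^2)).
  - apply continuous_on_coord.
  - intros x _. apply derivable_continuous_pt. reg.
Qed.

(** [y] fixes only the central line. The sign [sg], equal to 1 or -1, orients it: the height
    [sg * (x j - tau)] runs from 0 at the bottom, where the barrier vanishes, to [L] at the top,
    where a lower bound is given. *)
Definition tube {N} (y : pt N) (j : Fin.t N) (sg tau L rho : R) (x : pt N) :=
  0 <= sg * (x j - tau) <= L /\ dist2_off y j x <= rho^2.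

Definition tube_int {N} (y : pt N) (j : Fin.t N) (sg tau L rho : R) (x : pt N) :=
  0 < sg * (x j - tau) < L /\ dist2_off y j x < rho^2.

(** With [c = 1 / rho^2] it vanishes on the bottom and on the side of the tube. Near the side the
    axial second derivative degenerates; squaring the radial factor keeps the radial part of the
    Laplacian nonnegative there. *)
Definition barrier {N} (y : pt N) j sg tau c be (x : pt N) :=
  (exp (be * (sg * (x j - tau))) - 1) * (1 - c * dist2_off y j x)^2.

Definition barrier1 {N} (y : pt N) j sg tau c be (k : Fin.t N) (x : pt N) :=
  if Fin.eq_dec j k
  then be * sg * exp (be * (sg * (x j - tau))) * (1 - c * dist2_off y j x)^2
  else (exp (be * (sg * (x j - tau))) - 1) * (- 4 * c * (x k - y k) * (1 - c * dist2_off y j x)).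

Definition barrier2 {N} (y : pt N) j sg tau c be (k : Fin.t N) (x : pt N) :=
  if Fin.eq_dec j k
  then be^2 * exp (be * (sg * (x j - tau))) * (1 - c * dist2_off y j x)^2
  else (exp (be * (sg * (x j - tau))) - 1) *
       (8 * c^2 * (x k - y k)^2 - 4 * c * (1 - c * dist2_off y j x)).

Lemma barrier_pure_C2 {N} (A : pt N -> Prop) (y : pt N) j sg tau c be :
  sg * sg = 1 -> pure_C2 A (barrier y j sg tau c be) (barrier1 y j sg tau c be) (barrier2 y j sg tau c be).
Proof.
  intros Hsg.
  split; intros k x _; unfold has_partial; apply is_derive_Reals;
    unfold barrier, barrier1, barrier2; destruct (Fin.eq_dec j k) as [<-|E].
  - apply is_derive_ext with
      (fun t => (exp (be * (sg * (t - tau))) - 1) * (1 - c * dist2_off y j x)^2).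
    { intros t. rewrite upd_same, dist2_off_upd_same. reflexivity. }
    auto_derive; auto. unfold Rminus. ring.
  - set (S0 := dist2_off y j x - (x k - y k)^2).
    replace (dist2_off y j x) with (S0 + (x k - y k)^2) by (unfold S0; ring).
    apply is_derive_ext with
      (fun t => (exp (be * (sg * (x j - tau))) - 1) * (1 - c * (S0 + (t - y k)^2))^2).
    { intros t. rewrite (dist2_off_upd_other y j x k t E), (upd_other x k j) by auto. reflexivity. }
    auto_derive; auto. unfold Rminus. ring.
  - apply is_derive_ext with
      (fun t => be * sg * exp (be * (sg * (t - tau))) * (1 - c * dist2_off y j x)^2).
    { intros t. rewrite upd_same, dist2_off_upd_same. reflexivity. }
    auto_derive; auto.
    replace (be ^ 2) with (be * be * (sg * sg)) by (rewrite Hsg; ring). unfold Rminus. ring.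
  - set (S0 := dist2_off y j x - (x k - y k)^2).
    replace (dist2_off y j x) with (S0 + (x k - y k)^2) by (unfold S0; ring).
    apply is_derive_ext with
      (fun t => (exp (be * (sg * (x j - tau))) - 1) *
                (- 4 * c * (t - y k) * (1 - c * (S0 + (t - y k)^2)))).
    { intros t. rewrite (dist2_off_upd_other y j x k t E), upd_same, (upd_other x k j) by auto. reflexivity. }
    auto_derive; auto. unfold Rminus. ring.
Qed.

(** [C] pays for the zeroth-order term, the last summand absorbs the negative part of the radial
    Laplacian, and 1 makes the rate at most its square. Neither the length nor the position of the
    tube enters. *)
Definition tube_rate (N : nat) (C rho : R) : R := 1 + C + (INR N + 2)^2 / (2 * rho^2).

Lemma tube_rate_pos N C rho : 0 < C -> 0 < rho -> 0 < tube_rate N C rho.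
Proof.
  intros HC Hr. unfold tube_rate. pose proof (pos_INR N).
  assert (0 < (INR N + 2)^2 / (2 * rho^2)); [|lra].
  apply Rdiv_lt_0_compat; nra.
Qed.

(* The radial part needs [8 (1 - s) - 4 N s + (N + 2)^2 / 2 * s^2 >= 0] for
   [s = 1 - c * dist2_off]; the left-hand side is [((N + 2) s - 4)^2 / 2]. *)
Lemma barrier_subsolution {N} (y : pt N) j sg tau rho C x :
  0 < C -> 0 < rho -> 0 <= sg * (x j - tau) -> dist2_off y j x <= rho^2 ->
  C * barrier y j sg tau (/ rho^2) (tube_rate N C rho) x <=
  sumF N (fun k => barrier2 y j sg tau (/ rho^2) (tube_rate N C rho) k x).
Proof.
  intros HC Hr Hx HS.
  set (be := tube_rate N C rho). set (c := / rho^2).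
  assert (Hbe : be = 1 + C + (INR N + 2)^2 / 2 * c).
  { unfold be, tube_rate, c. field. lra. }
  assert (Hc : 0 < c) by (apply Rinv_0_lt_compat; nra).
  set (S := dist2_off y j x) in *.
  assert (HS0 : 0 <= S) by apply dist2_off_nonneg.
  set (s := 1 - c * S).
  assert (Hs : 0 <= s).
  { unfold s, c. apply (Rmult_le_compat_l c) in HS; [|lra]. unfold c in HS at 2.
    rewrite Rinv_l in HS by nra. fold c. lra. }
  set (e := exp (be * (sg * (x j - tau)))).
  assert (Hbe1 : 1 <= be).
  { rewrite Hbe. assert (0 <= (INR N + 2)^2 / 2 * c); [|lra].
    apply Rmult_le_pos; [|lra]. pose proof (pow2_ge_0 (INR N + 2)). lra. }
  assert (He : 1 <= e).
  { unfold e. rewrite <- exp_0. destruct (Req_dec (sg * (x j - tau)) 0) as [E|E].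
    - rewrite E, Rmult_0_r. lra.
    - left. apply exp_increasing. apply Rmult_lt_0_compat; lra. }
  rewrite (sumF_split N _ j).
  unfold barrier. fold S e s. unfold barrier2 at 1. fold S e s.
  destruct (Fin.eq_dec j j) as [_|Ef]; [|contradiction].
  (* All [N] directions are counted instead of the [N - 1] radial ones; the extra term, at [j], is
     nonpositive. *)
  assert (Hsum : (e - 1) * (8 * c * (c * S) - 4 * c * s * INR N) <=
    sumF N (fun l => if Fin.eq_dec j l then 0 else barrier2 y j sg tau c be l x)).
  { apply Rle_trans with (sumF N (fun l =>
      (fun _ => (e - 1) * (- 4 * c * s)) l
      + ((e - 1) * (8 * c^2)) * (if Fin.eq_dec j l then 0 else (x l - y l)^2))).
    - rewrite sumF_lin, sumF_const. fold (dist2_off y j x). fold S. right. ring.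
    - apply sumF_le. intros l. unfold barrier2. fold S e s. destruct (Fin.eq_dec j l); [|right; ring].
      assert (0 <= (e - 1) * (4 * c * s)); [|lra].
      apply Rmult_le_pos; [lra|]. apply Rmult_le_pos; lra. }
  eapply Rle_trans; [|apply Rplus_le_compat_l, Hsum].
  assert (HcS : c * S = 1 - s) by (unfold s; ring). rewrite HcS.
  assert (H1 : 0 <= (e - 1) * (c * (((INR N + 2) * s - 4)^2 / 2))).
  { apply Rmult_le_pos; [lra|]. apply Rmult_le_pos; [lra|].
    pose proof (pow2_ge_0 ((INR N + 2) * s - 4)). lra. }
  assert (H2 : (e - 1) * be * s^2 <= be^2 * e * s^2).
  { apply Rmult_le_compat_r; [apply pow2_ge_0|].
    assert (0 <= be * (e * (be - 1) + 1)); [|lra].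
    apply Rmult_le_pos; [lra|]. assert (0 <= e * (be - 1)) by (apply Rmult_le_pos; lra). lra. }
  assert (H3 : 0 <= (e - 1) * s^2) by (apply Rmult_le_pos; [lra | apply pow2_ge_0]).
  rewrite Hbe in H2 at 1. lra.
Qed.

Lemma tube_bounded {N} (y : pt N) j sg tau L rho :
  sg * sg = 1 -> is_bounded (tube y j sg tau L rho).
Proof.
  intros Hsg.
  destruct (argmax_F N (fun k => Rabs (y k)) j) as [m Hm].
  exists (Rabs (y m) + Rabs rho + Rabs tau + Rabs L). intros x [H1 H2] i.
  specialize (Hm i). cbn beta in Hm.
  pose proof (Rabs_pos (y m)). pose proof (Rabs_pos rho). pose proof (Rabs_pos tau). pose proof (Rabs_pos L).
  destruct (Fin.eq_dec j i) as [<-|E].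
  - assert (Rabs (x j - tau) <= Rabs L).
    { assert (E : Rabs sg = 1).
      { assert (Rabs sg * Rabs sg = 1) by (rewrite <- Rabs_mult, Hsg; apply Rabs_R1).
        pose proof (Rabs_pos sg). nra. }
      replace (Rabs (x j - tau)) with (Rabs (sg * (x j - tau))) by (rewrite Rabs_mult, E; ring).
      rewrite (Rabs_right (sg * (x j - tau))) by lra. pose proof (Rle_abs L). lra. }
    replace (x j) with (tau + (x j - tau)) by ring.
    pose proof (Rabs_triang tau (x j - tau)). lra.
  - pose proof (dist2_off_ge y j x i E).
    assert (Rabs (x i - y i) <= Rabs rho).
    { apply Rsqr_le_abs_0. unfold Rsqr. nra. }
    replace (x i) with (y i + (x i - y i)) by ring.
    pose proof (Rabs_triang (y i) (x i - y i)). lra.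
Qed.

Lemma closed_sublevel {N} (g : pt N -> R) c :
  continuous_on (fun _ => True) g -> is_closed (fun x => g x <= c).
Proof.
  intros Hg x Hx. apply Rnot_lt_le. intros Hlt.
  destruct (Hg x I (g x - c)) as [d [Hd H]]; [lra|].
  destruct (Hx d Hd) as [y [Hy Hn]]. specialize (H y I Hn). apply Rabs_def2 in H. lra.
Qed.

Lemma open_sublevel {N} (g : pt N -> R) c :
  continuous_on (fun _ => True) g -> is_open (fun x => g x < c).
Proof.
  intros Hg x Hx. destruct (Hg x I (c - g x)) as [d [Hd H]]; [lra|].
  exists d. split; auto. intros y Hn. specialize (H y I Hn). apply Rabs_def2 in H. lra.
Qed.

Lemma closed_and {N} (A B : pt N -> Prop) :
  is_closed A -> is_closed B -> is_closed (fun x => A x /\ B x).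
Proof.
  intros HA HB x Hx. split.
  - apply HA. eapply closure_mono; [|exact Hx]. cbv beta. tauto.
  - apply HB. eapply closure_mono; [|exact Hx]. cbv beta. tauto.
Qed.

Lemma open_and {N} (A B : pt N -> Prop) :
  is_open A -> is_open B -> is_open (fun x => A x /\ B x).
Proof.
  intros HA HB x [Ha Hb]. destruct (HA x Ha) as [r [Hr H1]]. destruct (HB x Hb) as [s [Hs H2]].
  exists (Rmin r s). split; [apply Rmin_pos; auto|]. intros y Hy. split.
  - apply H1. eapply near_le; [exact Hy | apply Rmin_l].
  - apply H2. eapply near_le; [exact Hy | apply Rmin_r].
Qed.

Lemma affine_coord_continuous {N} (A : pt N -> Prop) (j : Fin.t N) a b :
  continuous_on A (fun x : pt N => a * (x j - b)).
Proof.
  apply continuous_on_scal. apply continuous_on_minus;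
    [apply continuous_on_coord | apply continuous_on_const].
Qed.

Lemma tube_closed {N} (y : pt N) j sg tau L rho : is_closed (tube y j sg tau L rho).
Proof.
  assert (H : is_closed (fun x : pt N => (- sg * (x j - tau) <= 0 /\ sg * (x j - tau) <= L) /\
    dist2_off y j x <= rho^2)).
  { apply closed_and; [apply closed_and|]; apply closed_sublevel;
      auto using affine_coord_continuous, dist2_off_continuous. }
  intros x Hx. assert (Hx' := H x). unfold tube.
  destruct Hx' as [[Ha Hb] Hc]; [|split; [lra|auto]].
  eapply closure_mono; [|exact Hx]. intros z [Hz1 Hz2]. split; [split|]; auto; lra.
Qed.

Lemma tube_int_open {N} (y : pt N) j sg tau L rho : is_open (tube_int y j sg tau L rho).
Proof.
  assert (H : is_open (fun x : pt N => (- sg * (x j - tau) < 0 /\ sg * (x j - tau) < L) /\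
    dist2_off y j x < rho^2)).
  { apply open_and; [apply open_and|]; apply open_sublevel;
      auto using affine_coord_continuous, dist2_off_continuous. }
  intros x [Hx1 Hx2]. destruct (H x) as [r [Hr Hn]]; [split; [split|]; auto; lra|].
  exists r. split; auto. intros z Hz. destruct (Hn z Hz) as [[Ha Hb] Hc]. split; auto. lra.
Qed.

Lemma barrier_continuous {N} (A : pt N -> Prop) y j sg tau c be :
  continuous_on A (barrier y j sg tau c be).
Proof.
  apply continuous_on_mult.
  - apply (continuous_on_comp A (fun x : pt N => sg * (x j - tau)) (fun b => exp (be * b) - 1)).
    + apply affine_coord_continuous.
    + intros x _. apply derivable_continuous_pt. reg.
  - apply (continuous_on_comp A (dist2_off y j) (fun b => (1 - c * b)^2)).
    + apply dist2_off_continuous.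
    + intros x _. apply derivable_continuous_pt. reg.
Qed.

(** A quantitative Hopf lemma, by comparing [w] with [kap * h]. A negative minimum of the difference
    must be interior: [h] vanishes on the bottom and on the side, and the factor [exp (- (be * L))]
    in [kap] gives [kap * h <= a] on the top. At an interior one the Laplacian of [w - kap * h]
    would be nonnegative and also at most [C * (w - kap * h) < 0]. *)
Lemma tube_lower_bound {N} (y : pt N) j sg tau L rho C a w W1 W2 :
  sg * sg = 1 -> 0 < rho -> 0 < C -> 0 <= a ->
  continuous_on (tube y j sg tau L rho) w ->
  (forall x, tube y j sg tau L rho x -> 0 <= w x) ->
  (forall x, tube y j sg tau L rho x -> sg * (x j - tau) = L -> a <= w x) ->
  pure_C2 (tube_int y j sg tau L rho) w W1 W2 ->
  (forall x, tube_int y j sg tau L rho x -> sumF N (fun k => W2 k x) <= C * w x) ->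
  forall s, 0 <= s <= L ->
  a * exp (- (tube_rate N C rho * L)) * (exp (tube_rate N C rho * s) - 1) <= w (upd y j (tau + sg * s)).
Proof.
  intros Hsg Hr HC Ha Hcont Hpos Htop HC2 Hlap s Hs.
  set (be := tube_rate N C rho) in *. set (kap := a * exp (- (be * L))).
  assert (Hbe : 0 < be) by (apply tube_rate_pos; auto).
  assert (Hk : 0 <= kap). { apply Rmult_le_pos; auto. left; apply exp_pos. }
  set (c := / rho^2). set (h := barrier y j sg tau c be).
  assert (Hpt : tube y j sg tau L rho (upd y j (tau + sg * s))).
  { split; [|rewrite dist2_off_self; apply pow2_ge_0]. rewrite upd_same.
    replace (sg * (tau + sg * s - tau)) with (sg * sg * s) by ring. rewrite Hsg. lra. }
  destruct (continuous_attains_min (tube y j sg tau L rho) (fun x => w x - kap * h x)) as [x [Hx Hmin]].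
  { apply tube_bounded; auto. }
  { apply tube_closed. }
  { apply continuous_on_minus; auto. apply continuous_on_scal, barrier_continuous. }
  { eexists; exact Hpt. }
  assert (Hz : 0 <= w x - kap * h x).
  { apply Rnot_lt_le. intros Hneg.
    assert (Hwx : 0 <= w x) by auto.
    assert (Hint : tube_int y j sg tau L rho x).
    { destruct Hx as [[H1 H2] H3].
      assert (Hq : 0 <= (1 - c * dist2_off y j x)^2 <= 1).
      { assert (0 <= c * dist2_off y j x <= 1); [|nra].
        assert (0 < c) by (apply Rinv_0_lt_compat; nra).
        pose proof (dist2_off_nonneg y j x). split; [nra|].
        replace 1 with (c * rho^2) by (unfold c; field; lra). nra. }
      split; [split|].
      - destruct H1 as [H1|H1]; auto. exfalso. unfold h, barrier in Hneg.
        rewrite <- H1, Rmult_0_r, exp_0 in Hneg. lra.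
      - destruct H2 as [H2|H2]; auto. exfalso.
        assert (a <= w x) by (apply Htop; auto; split; [split|]; auto; lra).
        unfold h, barrier in Hneg. rewrite H2 in Hneg.
        assert (kap * ((exp (be * L) - 1) * (1 - c * dist2_off y j x) ^ 2) <= a); [|lra].
        assert (E : a = kap * exp (be * L)).
        { unfold kap. rewrite Rmult_assoc, <- exp_plus, Rplus_opp_l, exp_0. ring. }
        rewrite E. apply Rmult_le_compat_l; auto.
        assert (1 <= exp (be * L)).
        { rewrite <- exp_0. destruct (Req_dec L 0) as [->|]; [rewrite Rmult_0_r; lra|].
          left. apply exp_increasing. apply Rmult_lt_0_compat; lra. }
        nra.
      - destruct H3 as [H3|H3]; auto. exfalso. unfold h, barrier in Hneg.
        rewrite H3 in Hneg. replace (1 - c * rho ^ 2) with 0 in Hneg by (unfold c; field; lra).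
        lra. }
    destruct (tube_int_open y j sg tau L rho x Hint) as [r [Hr' Hball]].
    assert (Hd := pure_C2_at_min _ _ _ _ x r
      (pure_C2_lin _ kap w W1 W2 h _ _ HC2 (barrier_pure_C2 _ y j sg tau c be Hsg)) Hr').
    assert (Hcrit : forall k, 0 <= W2 k x - kap * barrier2 y j sg tau c be k x).
    { apply Hd. intros z Hz. split; auto. apply Hmin. destruct (Hball z Hz) as [Hb1 Hb2].
      split; lra. }
    specialize (Hlap x Hint).
    pose proof (barrier_subsolution y j sg tau rho C x HC Hr) as Hb.
    destruct Hint as [Hi1 Hi2]. specialize (Hb ltac:(lra) ltac:(lra)).
    fold be c h in Hb.
    assert (Hs2 : 0 <= sumF N (fun k => W2 k x) + - kap * sumF N (fun k => barrier2 y j sg tau c be k x)).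
    { rewrite <- sumF_lin. apply sumF_nonneg. intros k. specialize (Hcrit k). lra. }
    assert (kap * (C * h x) <= kap * sumF N (fun k => barrier2 y j sg tau c be k x))
      by (apply Rmult_le_compat_l; auto).
    nra. }
  specialize (Hmin _ Hpt). cbv beta in Hmin.
  assert (Eh : h (upd y j (tau + sg * s)) = exp (be * s) - 1).
  { unfold h, barrier. rewrite dist2_off_self, upd_same.
    replace (sg * (tau + sg * s - tau)) with (sg * sg * s) by ring. rewrite Hsg.
    replace (be * (1 * s)) with (be * s) by ring. ring. }
  rewrite Eh in Hmin. lra.
Qed.

(** * Counting dyadic cubes *)

Definition consn {N} (a : nat) (v : Fin.t N -> nat) : Fin.t (S N) -> nat :=
  fun i => Fin.caseS' i (fun _ => nat) a v.

Fixpoint product_list (N : nat) : (Fin.t N -> list nat) -> list (Fin.t N -> nat) :=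
  match N return (Fin.t N -> list nat) -> list (Fin.t N -> nat) with
  | O => fun _ => (fun _ => 0%nat) :: nil
  | S n => fun L =>
      flat_map (fun a => map (consn a) (product_list n (fun i => L (Fin.FS i)))) (L Fin.F1)
  end.

Lemma in_product_list N (L : Fin.t N -> list nat) z :
  In z (product_list N L) <-> forall i, In (z i) (L i).
Proof.
  induction N as [|n IH].
  - split; [intros _ i; apply (Fin.case0 (fun _ => _) i)|]. intros _. left.
    apply functional_extensionality. intros i. apply (Fin.case0 (fun _ => _) i).
  - simpl. rewrite in_flat_map. split.
    + intros [a [Ha Hz]] i. apply in_map_iff in Hz. destruct Hz as [v [<- Hv]].
      rewrite IH in Hv. apply (Fin.caseS' i); auto.
    + intros H. exists (z Fin.F1). split; auto. apply in_map_iff.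
      exists (fun i => z (Fin.FS i)). split; [|apply IH; auto].
      apply functional_extensionality. intros i. apply (Fin.caseS' i); reflexivity.
Qed.

Lemma NoDup_flat_map_disjoint {A B} (F : A -> list B) (l : list A) :
  NoDup l -> (forall a, In a l -> NoDup (F a)) ->
  (forall a b x, In a l -> In b l -> In x (F a) -> In x (F b) -> a = b) -> NoDup (flat_map F l).
Proof.
  induction l as [|a l IH]; intros Hl HF Hd; simpl; [constructor|].
  inversion Hl; subst. apply NoDup_app.
  - apply HF; left; reflexivity.
  - apply IH; auto.
    + intros; apply HF; right; auto.
    + intros b c x Hb Hc. apply Hd; right; auto.
  - intros x Hx Hx2. apply in_flat_map in Hx2. destruct Hx2 as [b [Hb Hxb]].
    rewrite (Hd a b x) in H1; simpl; auto.
Qed.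

Lemma consn_inj {N} a b (v v' : Fin.t N -> nat) : consn a v = consn b v' -> a = b /\ v = v'.
Proof.
  intros H. split.
  - exact (f_equal (fun z => z Fin.F1) H).
  - apply functional_extensionality. intros i. exact (f_equal (fun z => z (Fin.FS i)) H).
Qed.

Lemma NoDup_product_list N (L : Fin.t N -> list nat) :
  (forall i, NoDup (L i)) -> NoDup (product_list N L).
Proof.
  induction N as [|n IH]; intros H; simpl; [constructor; [intros []|constructor]|].
  apply NoDup_flat_map_disjoint; auto.
  - intros a _. apply NoDup_map_NoDup_ForallPairs; auto.
    intros v v' _ _ E. apply consn_inj in E. tauto.
  - intros a b x _ _ Ha Hb. apply in_map_iff in Ha. apply in_map_iff in Hb.
    destruct Ha as [v [<- _]], Hb as [v' [E _]]. apply consn_inj in E. symmetry; tauto.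
Qed.

Lemma length_product_list_step n (L : Fin.t (S n) -> list nat) :
  length (product_list (S n) L) = (length (L Fin.F1) * length (product_list n (fun i => L (Fin.FS i))))%nat.
Proof.
  simpl. induction (L Fin.F1) as [|a l IH]; simpl; auto.
  rewrite length_app, length_map, IH. reflexivity.
Qed.

Lemma length_product_list N (L : Fin.t N -> list nat) m :
  (forall i, length (L i) = m) -> length (product_list N L) = (m ^ N)%nat.
Proof.
  induction N as [|n IH]; intros H; [reflexivity|].
  rewrite length_product_list_step, H, IH; auto.
Qed.

(** The bound [a * m ^ (N - 1)], multiplied by [m] to avoid a truncated exponent. *)
Lemma length_product_list_one N (L : Fin.t N -> list nat) k a m :
  (length (L k) <= a)%nat -> (forall i, k <> i -> length (L i) = m) ->
  (length (product_list N L) * m <= a * m ^ N)%nat.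
Proof.
  induction N as [|n IH]; [apply (Fin.case0 (fun _ => _) k)|].
  rewrite length_product_list_step. apply (Fin.caseS' k).
  - intros Ha H. rewrite (length_product_list n _ m) by (intros; apply H; discriminate).
    rewrite Nat.pow_succ_r', (Nat.mul_comm m (m ^ n)), <- Nat.mul_assoc.
    apply Nat.mul_le_mono_r. exact Ha.
  - intros k' Ha H. rewrite (H Fin.F1) by discriminate.
    assert (E := IH (fun i => L (Fin.FS i)) k' Ha).
    simpl Nat.pow. rewrite <- !Nat.mul_assoc.
    transitivity (m * (a * m ^ n))%nat; [|lia].
    apply Nat.mul_le_mono_l, E. intros i Hi. apply H. intros E'. apply Fin.FS_inj in E'. auto.
Qed.

(* Closed dyadic cube of side [1 / 2^k]; the shift by [B] makes the indices of the cubes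
   of the box [|x i| <= B] natural numbers. *)
Definition cube {N} (B k : nat) (z : Fin.t N -> nat) (x : pt N) : Prop :=
  forall i, INR (z i) <= 2 ^ k * (x i + INR B) <= INR (z i) + 1.

Lemma pow2_pos k : 0 < 2 ^ k.
Proof. apply pow_lt; lra. Qed.

Lemma INR_pow2 k : INR (2 ^ k) = 2 ^ k.
Proof. rewrite pow_INR. reflexivity. Qed.

Lemma pow2_large M : exists k0, forall k, (k0 <= k)%nat -> M < 2 ^ k.
Proof.
  destruct (INR_unbounded M) as [n Hn]. exists n. intros k Hk.
  assert (n < 2 ^ k)%nat.
  { eapply Nat.le_lt_trans; [exact Hk|]. apply Nat.pow_gt_lin_r. lia. }
  apply lt_INR in H. rewrite INR_pow2 in H. lra.
Qed.

Lemma cube_exists {N} (B k : nat) (x : pt N) :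
  (forall i, Rabs (x i) <= INR B) -> exists z, cube B k z x.
Proof.
  intros H.
  destruct (choice (fun i n => INR n <= 2 ^ k * (x i + INR B) < INR n + 1)) as [z Hz].
  - intros i. specialize (H i). apply Rabs_le_bounds in H. pose proof (pow2_pos k).
    destruct (nfloor_ex (2 ^ k * (x i + INR B))) as [n Hn]; [apply Rmult_le_pos; lra|].
    exists n; exact Hn.
  - exists z. intros i. specialize (Hz i). lra.
Qed.

Lemma cube_corner {N} (B k : nat) (z : Fin.t N -> nat) :
  cube B k z (fun i => (INR (z i) + 1) / 2 ^ k - INR B).
Proof.
  intros i. pose proof (pow2_pos k).
  replace (2 ^ k * ((INR (z i) + 1) / 2 ^ k - INR B + INR B)) with (INR (z i) + 1) by (field; lra).
  lra.
Qed.

Lemma cube_near {N} (B k : nat) (z : Fin.t N -> nat) x y :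
  cube B k z x -> cube B k z y -> forall i, Rabs (x i - y i) <= / 2 ^ k.
Proof.
  intros Hx Hy i. specialize (Hx i). specialize (Hy i). pose proof (pow2_pos k).
  apply (Rmult_le_reg_l (2 ^ k)); auto. rewrite Rinv_r by lra.
  rewrite <- (Rabs_right (2 ^ k)) at 1 by lra. rewrite <- Rabs_mult. apply Rabs_le. lra.
Qed.

(** The upper corner belongs to the closed cube, hence to the box; this is what makes the bound
    strict. *)
Lemma cube_index_bound {N} (B k : nat) (z : Fin.t N -> nat) :
  (forall x, cube B k z x -> forall i, Rabs (x i) <= INR B) ->
  forall i, (z i < 2 * B * 2 ^ k)%nat.
Proof.
  intros H i. specialize (H _ (cube_corner B k z) i). apply Rabs_le_bounds in H.
  apply INR_le. rewrite S_INR, !mult_INR, INR_pow2. change (INR 2) with 2. pose proof (pow2_pos k).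
  apply (Rmult_le_reg_r (/ 2 ^ k)); [apply Rinv_0_lt_compat; lra|].
  replace (2 * INR B * 2 ^ k * / 2 ^ k) with (2 * INR B) by (field; lra).
  fold ((INR (z i) + 1) / 2 ^ k). lra.
Qed.

Lemma cube_count_bound {N} (B k : nat) (l : list (Fin.t N -> nat)) :
  NoDup l -> (forall z, In z l -> forall x, cube B k z x -> forall i, Rabs (x i) <= INR B) ->
  (length l <= (2 * B * 2 ^ k) ^ N)%nat.
Proof.
  intros Hl H. rewrite <- (length_product_list N (fun _ => seq 0 (2 * B * 2 ^ k))).
  - apply NoDup_incl_length; auto. intros z Hz. apply in_product_list. intros i.
    apply in_seq. split; [lia|]. apply cube_index_bound. intros x Hx. apply (H z Hz x Hx).
  - intros i. apply length_seq.
Qed.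

(** Indices, at level [k + e], of the subcubes of the cube [z] of level [k]. *)
Definition cube_children {N} (e : nat) (z : Fin.t N -> nat) : list (Fin.t N -> nat) :=
  product_list N (fun i => seq (z i * 2 ^ e) (2 ^ e)).

Lemma in_cube_children {N} e (z c : Fin.t N -> nat) :
  In c (cube_children e z) <-> forall i, (z i * 2 ^ e <= c i < z i * 2 ^ e + 2 ^ e)%nat.
Proof.
  unfold cube_children. rewrite in_product_list.
  split; intros H i; specialize (H i); apply in_seq; auto.
Qed.

Lemma cube_child_subset {N} B k e (z c : Fin.t N -> nat) x :
  In c (cube_children e z) -> cube B (k + e) c x -> cube B k z x.
Proof.
  intros Hc Hx i. rewrite in_cube_children in Hc. specialize (Hc i). specialize (Hx i).
  destruct Hc as [H1 H2]. apply le_INR in H1. apply le_INR in H2.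
  rewrite S_INR, plus_INR, !mult_INR, INR_pow2 in *. rewrite pow_add in Hx.
  pose proof (pow2_pos e). pose proof (pow2_pos k).
  set (v := 2 ^ k * (x i + INR B)).
  replace (2 ^ k * 2 ^ e * (x i + INR B)) with (v * 2 ^ e) in Hx by (unfold v; ring).
  split; apply (Rmult_le_reg_r (2 ^ e)); auto; lra.
Qed.

Lemma cube_children_disjoint {N} e (z z' c : Fin.t N -> nat) :
  In c (cube_children e z) -> In c (cube_children e z') -> z = z'.
Proof.
  rewrite !in_cube_children. intros H H'. apply functional_extensionality. intros i.
  specialize (H i). specialize (H' i). nia.
Qed.

(* The volume of finite unions of dyadic cubes contained in [A] is bounded, so some finite
   union [K] nearly attains the supremum; finer cubes of [A] not inside [K] then have small
   total volume, since they could be added to [K]. *)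
Lemma inner_dyadic_approximation {N} (A : pt N -> Prop) (B : nat) theta :
  (forall x, A x -> forall i, Rabs (x i) <= INR B) -> 0 < theta ->
  exists k0 l0, (forall z, In z l0 -> forall x, cube B k0 z x -> A x) /\
    forall k l, (k0 <= k)%nat -> NoDup l ->
      (forall z, In z l -> (forall x, cube B k z x -> A x) /\
         exists x, cube B k z x /\ ~ exists z0, In z0 l0 /\ cube B k0 z0 x) ->
      INR (length l) <= theta * (2 ^ k) ^ N.
Proof.
  intros HB Ht.
  assert (Hpp : forall k, 0 < (2 ^ k) ^ N) by (intros; apply pow_lt, pow2_pos).
  set (E := fun v => exists k l, NoDup l /\ (forall z, In z l -> forall x, cube B k z x -> A x) /\
     v = INR (length l) / (2 ^ k) ^ N).
  destruct (completeness E) as [V [HV1 HV2]].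
  { exists ((2 * INR B) ^ N). intros v [k [l [Hl [Hz ->]]]].
    apply (Rmult_le_reg_r ((2 ^ k) ^ N)); auto.
    replace (INR (length l) / (2 ^ k) ^ N * (2 ^ k) ^ N) with (INR (length l))
      by (field; specialize (Hpp k); lra).
    rewrite <- Rpow_mult_distr.
    replace (2 * INR B * 2 ^ k) with (INR (2 * B * 2 ^ k)) by (rewrite !mult_INR, INR_pow2; reflexivity).
    rewrite <- pow_INR. apply le_INR. apply cube_count_bound; auto.
    intros z Hz' x Hx. apply HB. apply (Hz z); auto. }
  { exists 0. exists 0%nat, nil. split; [constructor|]. split; [intros z []|]. simpl. field.
    apply pow_nonzero; lra. }
  assert (HE : exists v, E v /\ V - theta < v).
  { apply NNPP. intros HN. assert (V <= V - theta); [|lra]. apply HV2. intros v Hv.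
    apply Rnot_lt_le. intros Hlt. apply HN. exists v; auto. }
  destruct HE as [v [[k0 [l0 [Hl0 [Hz0 ->]]]] HVt]].
  exists k0, l0. split; auto. intros k l Hk Hl Hz.
  set (e := (k - k0)%nat). assert (Ek : k = (k0 + e)%nat) by (unfold e; lia).
  set (l' := l ++ flat_map (cube_children e) l0).
  assert (HE' : E (INR (length l') / (2 ^ k) ^ N)).
  { exists k, l'. split; [|split; auto].
    - apply NoDup_app; auto.
      + apply NoDup_flat_map_disjoint; auto.
        * intros z _. apply NoDup_product_list. intros; apply seq_NoDup.
        * intros a b x _ _. apply cube_children_disjoint.
      + intros c Hc Hc2. apply in_flat_map in Hc2. destruct Hc2 as [z0 [Hz0' Hcz]].
        destruct (Hz c Hc) as [_ [x [Hx HN]]]. apply HN. exists z0. split; auto.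
        rewrite Ek in Hx. eapply cube_child_subset; eauto.
    - intros z Hin x Hx. apply in_app_or in Hin. destruct Hin as [Hin|Hin].
      + apply (Hz z Hin); auto.
      + apply in_flat_map in Hin. destruct Hin as [z0 [Hz0' Hcz]]. apply (Hz0 z0 Hz0').
        rewrite Ek in Hx. eapply cube_child_subset; eauto. }
  assert (Hlen : length (flat_map (cube_children e) l0) = (length l0 * (2 ^ e) ^ N)%nat).
  { apply flat_map_constant_length. intros z _. apply length_product_list. intros i. apply length_seq. }
  specialize (HV1 _ HE'). unfold l' in HV1. rewrite length_app, Hlen in HV1.
  rewrite plus_INR, mult_INR, pow_INR, INR_pow2 in HV1.
  assert (Epow : (2 ^ k) ^ N = (2 ^ k0) ^ N * (2 ^ e) ^ N).
  { rewrite Ek, pow_add, Rpow_mult_distr. reflexivity. }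
  pose proof (Hpp k). pose proof (Hpp k0). pose proof (Hpp e).
  assert (E1 : INR (length l0) * (2 ^ e) ^ N = INR (length l0) / (2 ^ k0) ^ N * (2 ^ k) ^ N).
  { rewrite Epow. field. lra. }
  rewrite E1 in HV1.
  apply (Rmult_le_compat_r ((2 ^ k) ^ N)) in HV1; [|lra].
  replace ((INR (length l) + INR (length l0) / (2 ^ k0) ^ N * (2 ^ k) ^ N) / (2 ^ k) ^ N * (2 ^ k) ^ N)
    with (INR (length l) + INR (length l0) / (2 ^ k0) ^ N * (2 ^ k) ^ N) in HV1 by (field; lra).
  nra.
Qed.

(** For a cube meeting the slab the index in direction [i] lies in a window of at most
    [2 ^ k * (hi - lo) + 2] integers; the other indices are below [2 * B * 2 ^ k]. *)
Lemma slab_count {N} (B k : nat) (i : Fin.t N) lo hi (l : list (Fin.t N -> nat)) :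
  NoDup l -> lo <= hi ->
  (forall z, In z l -> (forall x, cube B k z x -> forall j, Rabs (x j) <= INR B) /\
     exists x, cube B k z x /\ lo <= x i <= hi) ->
  INR (length l) * (2 * INR B * 2 ^ k) <= (2 ^ k * (hi - lo) + 2) * (2 * INR B * 2 ^ k) ^ N.
Proof.
  intros Hl Hlh H. pose proof (pow2_pos k) as Hp.
  assert (EM : 2 * INR B * 2 ^ k = INR (2 * B * 2 ^ k)) by (rewrite !mult_INR, INR_pow2; reflexivity).
  (* A cube of the list is needed to know that [hi + INR B] is nonnegative and has a natural integer
     part. *)
  destruct l as [|z1 l1].
  { simpl length. simpl INR. rewrite Rmult_0_l. apply Rmult_le_pos.
    - assert (0 <= 2 ^ k * (hi - lo)) by (apply Rmult_le_pos; lra). lra.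
    - rewrite EM. apply pow_le, pos_INR. }
  set (l := z1 :: l1) in *.
  assert (Hhi : 0 <= 2 ^ k * (hi + INR B)).
  { destruct (H z1) as [_ [x [Hx Hxi]]]; [left; reflexivity|]. specialize (Hx i).
    pose proof (pos_INR (z1 i)).
    apply Rle_trans with (2 ^ k * (x i + INR B)); [lra|]. apply Rmult_le_compat_l; lra. }
  destruct (nfloor_ex _ Hhi) as [a Ha].
  (* The [+ 1] makes room for cubes that reach the slab only through their upper face. If [a - d] is
     truncated, the window starts at 0 and still contains [a]. *)
  destruct (nfloor_ex (2 ^ k * (hi - lo) + 1)) as [d Hd].
  { assert (0 <= 2 ^ k * (hi - lo)) by (apply Rmult_le_pos; lra). lra. }
  set (L := fun j : Fin.t N => if Fin.eq_dec i j then seq (a - d) (S d) else seq 0 (2 * B * 2 ^ k)).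
  assert (Hincl : incl l (product_list N L)).
  { intros z Hz. apply in_product_list. intros j. unfold L.
    destruct (H z Hz) as [Hbox [x [Hx Hxi]]]. destruct (Fin.eq_dec i j) as [<-|E].
    - apply in_seq. specialize (Hx i).
      assert (H1 : (z i < S a)%nat).
      { apply INR_lt. rewrite S_INR.
        assert (2 ^ k * (x i + INR B) <= 2 ^ k * (hi + INR B)) by (apply Rmult_le_compat_l; lra). lra. }
      assert (H2 : (a < S (z i + d))%nat).
      { apply INR_lt. rewrite S_INR, plus_INR.
        assert (2 ^ k * (lo + INR B) <= 2 ^ k * (x i + INR B)) by (apply Rmult_le_compat_l; lra). lra. }
      lia.
    - apply in_seq. split; [lia|]. apply cube_index_bound; auto. }
  assert (Hlen : (length l * (2 * B * 2 ^ k) <= S d * (2 * B * 2 ^ k) ^ N)%nat).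
  { eapply Nat.le_trans; [apply Nat.mul_le_mono_r, (NoDup_incl_length Hl Hincl)|].
    apply (length_product_list_one N L i).
    - unfold L. destruct (Fin.eq_dec i i); [|contradiction]. rewrite length_seq. lia.
    - intros j Hj. unfold L. destruct (Fin.eq_dec i j); [contradiction|]. apply length_seq. }
  apply le_INR in Hlen. rewrite !(mult_INR (length l)), (mult_INR (S d)), pow_INR, <- EM in Hlen.
  eapply Rle_trans; [exact Hlen|]. apply Rmult_le_compat_r.
  - rewrite EM. apply pow_le, pos_INR.
  - rewrite S_INR. lra.
Qed.

(** [delta] is such that a slab of width [2 * delta] cuts a volume [theta] out of the box of side
    [2 B]. One [delta] is the slab itself; the other absorbs the two extra layers of cubes once
    [2 <= delta * 2 ^ k]. *)
Lemma thin_slab_count (N B : nat) theta :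
  (1 <= B)%nat -> 0 < theta ->
  exists delta k0, 0 < delta /\ forall k (i : Fin.t N) lo hi l, (k0 <= k)%nat -> NoDup l ->
    lo <= hi <= lo + delta ->
    (forall z, In z l -> (forall x, cube B k z x -> forall j, Rabs (x j) <= INR B) /\
       exists x, cube B k z x /\ lo <= x i <= hi) ->
    INR (length l) <= theta * (2 ^ k) ^ N.
Proof.
  intros HB Ht. apply le_INR in HB. simpl in HB.
  assert (Hq : 0 < (2 * INR B) ^ N) by (apply pow_lt; lra).
  set (q := (2 * INR B) ^ N) in *.
  set (delta := theta * INR B / q).
  assert (Hdel : 0 < delta) by (apply Rdiv_lt_0_compat; nra).
  destruct (pow2_large (2 / delta)) as [k0 Hk0].
  exists delta, k0. split; auto. intros k i lo hi l Hk Hl Hlh H.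
  specialize (Hk0 k Hk). pose proof (pow2_pos k) as Hp.
  assert (H2 : 2 <= delta * 2 ^ k).
  { apply (Rmult_lt_compat_l delta) in Hk0; auto.
    replace (delta * (2 / delta)) with 2 in Hk0 by (field; lra). lra. }
  pose proof (slab_count B k i lo hi l Hl (proj1 Hlh) H) as Hc.
  rewrite Rpow_mult_distr in Hc. fold q in Hc.
  assert (Hpp : 0 < (2 ^ k) ^ N) by (apply pow_lt; auto).
  apply (Rmult_le_reg_r (2 * INR B * 2 ^ k)); [nra|].
  eapply Rle_trans; [exact Hc|].
  replace (theta * (2 ^ k) ^ N * (2 * INR B * 2 ^ k)) with ((2 * (delta * 2 ^ k)) * (q * (2 ^ k) ^ N))
    by (unfold delta; field; lra).
  apply Rmult_le_compat_r; [nra|].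
  assert (2 ^ k * (hi - lo) <= delta * 2 ^ k); [|lra].
  rewrite (Rmult_comm delta). apply Rmult_le_compat_l; lra.
Qed.

(** * Maximum principle in sets of small volume *)

Lemma uniform_radius N (Q : Fin.t N -> R -> Prop) :
  (forall k r s, Q k s -> r <= s -> Q k r) -> (forall k, exists r, 0 < r /\ Q k r) ->
  exists r, 0 < r /\ forall k, Q k r.
Proof.
  induction N as [|n IH]; intros Hmono H.
  - exists 1. split; [lra|]. intros k. apply (Fin.case0 (fun _ => _) k).
  - destruct (IH (fun k => Q (Fin.FS k))) as [r [Hr Hq]]; auto.
    { intros k. apply Hmono. }
    destruct (H Fin.F1) as [s [Hs Hq1]].
    exists (Rmin r s). split; [apply Rmin_pos; auto|]. intros k. apply (Fin.caseS' k).
    + apply (Hmono _ _ s); auto. apply Rmin_r.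
    + intros k'. apply (Hmono _ _ r); auto. apply Rmin_l.
Qed.

(** Two mean value theorems. The intermediate point [c] lies between [t0] and [t0 + s], so
    [(c - t0) * s] lies between 0 and [s^2] for either sign of [s]; this gives the constant [M] in
    place of [M / 2]. *)
Lemma taylor_upper g g1 g2 t0 s M :
  (forall t, Rabs (t - t0) <= Rabs s -> derivable_pt_lim g t (g1 t)) ->
  (forall t, Rabs (t - t0) <= Rabs s -> derivable_pt_lim g1 t (g2 t)) ->
  (forall t, Rabs (t - t0) <= Rabs s -> g2 t <= M) -> 0 <= M ->
  g (t0 + s) <= g t0 + s * g1 t0 + M * s^2.
Proof.
  intros H1 H2 H3 HM.
  assert (Hin : forall v t, Rmin t0 (t0 + v) <= t <= Rmax t0 (t0 + v) -> Rabs (t - t0) <= Rabs v).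
  { intros v t. unfold Rmin, Rmax, Rabs.
    destruct (Rle_dec t0 (t0 + v)), (Rcase_abs (t - t0)), (Rcase_abs v); lra. }
  destruct (MVT_gen g t0 (t0 + s) g1) as [c [Hc Ec]].
  - intros t Ht. apply is_derive_Reals. apply H1, Hin. lra.
  - intros t Ht. apply derivable_continuous_pt. exists (g1 t). apply H1, Hin. exact Ht.
  - assert (Hcs : Rabs (c - t0) <= Rabs s) by (apply Hin; exact Hc).
    destruct (MVT_gen g1 t0 (t0 + (c - t0)) g2) as [b [Hb Eb]].
    + intros t Ht. apply is_derive_Reals. apply H2.
      eapply Rle_trans; [|exact Hcs]. apply Hin. lra.
    + intros t Ht. apply derivable_continuous_pt. exists (g2 t). apply H2.
      eapply Rle_trans; [|exact Hcs]. apply Hin. exact Ht.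
    + assert (Hbs : g2 b <= M). { apply H3. eapply Rle_trans; [|exact Hcs]. apply Hin. exact Hb. }
      replace (t0 + (c - t0)) with c in Eb by ring.
      assert (Ht : 0 <= (c - t0) * s <= s^2).
      { revert Hc. unfold Rmin, Rmax. destruct (Rle_dec t0 (t0 + s)); intros Hc; nra. }
      assert (E : g (t0 + s) = g t0 + s * g1 t0 + g2 b * ((c - t0) * s)).
      { replace (t0 + s - t0) with s in Ec by ring. replace (g1 c) with (g1 t0 + g2 b * (c - t0)) in Ec by lra.
        lra. }
      assert (g2 b * ((c - t0) * s) <= M * ((c - t0) * s)) by (apply Rmult_le_compat_r; lra).
      assert (M * ((c - t0) * s) <= M * s^2) by (apply Rmult_le_compat_l; lra).
      lra.
Qed.

Definition dot {N} (p x : pt N) : R := sumF N (fun k => p k * x k).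

Lemma dot_minus_r {N} (p x y : pt N) : dot p (fun k => x k - y k) = dot p x - dot p y.
Proof.
  unfold dot. rewrite (sumF_ext N _ (fun k => p k * x k + (-1) * (p k * y k))) by (intros; ring).
  rewrite sumF_lin. ring.
Qed.

Lemma dot_minus_l {N} (p q x : pt N) : dot (fun k => p k - q k) x = dot p x - dot q x.
Proof.
  unfold dot. rewrite (sumF_ext N _ (fun k => p k * x k + (-1) * (q k * x k))) by (intros; ring).
  rewrite sumF_lin. ring.
Qed.

Lemma dot_upd {N} (p x : pt N) k t : dot p (upd x k t) = dot p x + p k * (t - x k).
Proof.
  unfold dot. rewrite (sumF_replace N (fun l b => p l * b)). ring.
Qed.

Lemma dot_bound {N} (p x : pt N) a b :
  (forall k, Rabs (p k) <= a) -> (forall k, Rabs (x k) <= b) -> Rabs (dot p x) <= INR N * (a * b).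
Proof.
  intros Hp Hx. unfold dot. eapply Rle_trans; [apply Rabs_sumF|].
  rewrite <- sumF_const. apply sumF_le. intros k. rewrite Rabs_mult.
  apply Rmult_le_compat; auto using Rabs_pos.
Qed.

Lemma dot_continuous {N} (A : pt N -> Prop) p : continuous_on A (dot p).
Proof.
  apply (continuous_on_sumF A N (fun k x => p k * x k)). intros k.
  apply continuous_on_scal, continuous_on_coord.
Qed.

Lemma dot_pure_C2 {N} (A : pt N -> Prop) p : pure_C2 A (dot p) (fun k _ => p k) (fun _ _ => 0).
Proof.
  split; intros k x _; unfold has_partial; apply is_derive_Reals.
  - apply is_derive_ext with (fun t => dot p x + p k * (t - x k)).
    + intros t. symmetry. apply dot_upd.
    + auto_derive; auto. ring.
  - auto_derive; auto.
Qed.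

(* Two touching points whose supporting slopes differ much cannot be close: move from [x]
   by [2 N h] in the coordinate direction where the slopes differ most. *)
Lemma supporting_slopes_close {N} (A : pt N -> Prop) w W1 W2 M h r0 (x x' p q : pt N) :
  pure_C2 A w W1 W2 -> 0 <= M -> 0 < h -> 2 * INR N * h < r0 ->
  (forall y, near x y r0 -> A y /\ forall k, W2 k y <= M) ->
  (forall k, W1 k x = p k) ->
  (forall y, A y -> w x - dot p x <= w y - dot p y) ->
  (forall y, A y -> w x' - dot q x' <= w y - dot q y) ->
  A x' -> (forall k, Rabs (x k - x' k) <= h) ->
  forall k, Rabs (p k - q k) <= 4 * M * INR N * h.
Proof.
  intros HC2 HM Hh Hr Hball Hp Hx Hx' HAx' Hnear k0.
  destruct (argmax_F N (fun k => Rabs (p k - q k)) k0) as [k Hk]. cbv beta in Hk.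
  eapply Rle_trans; [apply Hk|].
  assert (HN : 1 <= INR N).
  { destruct N as [|n]; [apply (Fin.case0 (fun _ => _) k)|]. rewrite S_INR. pose proof (pos_INR n). lra. }
  set (m := Rabs (p k - q k)) in *.
  assert (Hm : 0 <= m) by apply Rabs_pos.
  assert (Hsg : exists s, Rabs s = 2 * INR N * h /\ s * (p k - q k) = - (2 * INR N * h * m)).
  { assert (0 <= 2 * INR N * h) by nra. unfold m, Rabs at 2. destruct (Rcase_abs (p k - q k)).
    - exists (2 * INR N * h). split; [apply Rabs_right; lra | ring].
    - exists (- (2 * INR N * h)). split; [rewrite Rabs_Ropp; apply Rabs_right; lra | ring]. }
  destruct Hsg as [s [Hs1 Hs2]].
  assert (Hline : forall t, Rabs (t - x k) <= Rabs s -> near x (upd x k t) r0).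
  { intros t Ht. apply near_upd_self. rewrite Hs1 in Ht. lra. }
  destruct HC2 as [HC1 HC2].
  assert (Htaylor : w (upd x k (x k + s)) <= w x + s * p k + M * s^2).
  { pose proof (taylor_upper (fun t => w (upd x k t)) (fun t => W1 k (upd x k t))
      (fun t => W2 k (upd x k t)) (x k) s M) as T.
    cbv beta in T. rewrite upd_id, Hp in T. apply T; auto.
    - intros t Ht. apply has_partial_line, HC1, Hball, Hline, Ht.
    - intros t Ht. apply has_partial_line, HC2, Hball, Hline, Ht.
    - intros t Ht. apply Hball, Hline, Ht. }
  assert (HAy : A (upd x k (x k + s))).
  { apply Hball, Hline. right. f_equal. ring. }
  specialize (Hx' _ HAy). specialize (Hx _ HAx').
  rewrite dot_upd in Hx'. replace (x k + s - x k) with s in Hx' by ring.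
  assert (Hd : Rabs (dot (fun k => p k - q k) (fun k => x k - x' k)) <= INR N * (m * h)).
  { apply dot_bound; auto. }
  rewrite dot_minus_l, !dot_minus_r in Hd. apply Rabs_le_bounds in Hd.
  assert (Hs3 : s^2 = (2 * INR N * h)^2) by (rewrite <- Hs1, pow2_abs; reflexivity).
  rewrite Hs3 in Htaylor.
  (* Adding the two touching inequalities: the move gains [2 N h m], passing from [x] to [x'] costs
     at most [N h m], and the Taylor remainder is [M (2 N h)^2]. *)
  assert (H : (INR N * h) * m <= (INR N * h) * (4 * M * INR N * h)) by lra.
  apply Rmult_le_reg_l in H; nra.
Qed.

(* Discretised Alexandroff-Bakelman-Pucci estimate: if [w] had a negative minimum [-m], every
   slope of size [c m] would be the slope of a supporting plane touching [w] at a point where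
   [w < 0]. At touching points the Hessian is at most [C m], so slopes taken on a grid of step
   comparable to [C m h] touch in distinct cubes of side [h], and the cubes meeting [w < 0]
   would fill a volume bounded below. *)
Lemma maximum_principle_small_volume (N B : nat) (C : R) :
  (1 <= N)%nat -> (1 <= B)%nat -> 0 < C ->
  exists theta, 0 < theta /\ forall (Sg : pt N -> Prop) w W1 W2,
    is_open Sg -> (forall x, Sg x -> forall i, Rabs (x i) <= INR B) ->
    continuous_on (closure Sg) w -> (forall x, boundary Sg x -> 0 <= w x) ->
    pure_C2 Sg w W1 W2 -> (forall k, continuous_on Sg (W2 k)) ->
    (forall x, Sg x -> w x < 0 -> sumF N (fun k => W2 k x) <= - C * w x) ->
    (exists k0, forall k l, (k0 <= k)%nat -> NoDup l ->
       (forall z, In z l -> (forall x, cube B k z x -> Sg x) /\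
          exists x, cube B k z x /\ Sg x /\ w x < 0) ->
       INR (length l) <= theta * (2 ^ k) ^ N) ->
    forall x, Sg x -> 0 <= w x.
Proof.
  intros HN HB HC.
  assert (HN' : 1 <= INR N) by (apply le_INR in HN; exact HN).
  assert (HB' : 1 <= INR B) by (apply le_INR in HB; exact HB).
  (* [K] is fitted to the grid of slopes. Slopes bounded by [m / (8 N B)] change a linear function
     by at most [m / 4] between two points of the box; with step [eta] this leaves
     [X = 2 * 2 ^ k / K] steps per direction, hence at least [2 ^ k / K] grid values after rounding
     down. The factor 1/2 in [theta] makes the final count contradictory. *)
  set (K := 144 * C * INR N ^ 2 * INR B).
  assert (HK : 0 < K). { unfold K. repeat apply Rmult_lt_0_compat; try lra; nra. }
  exists (/ 2 * (/ K) ^ N). split.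
  { apply Rmult_lt_0_compat; [lra|]. apply pow_lt, Rinv_0_lt_compat; auto. }
  intros Sg w W1 W2 Hop Hbox Hcont Hbd HC2 HW2 Hlap [k0 Hvol] xx Hxx.
  apply Rnot_lt_le. intros Hneg.
  assert (Hcl : is_bounded (closure Sg)) by (exists (INR B); apply closure_bounded; auto).
  destruct (continuous_attains_min (closure Sg) w) as [x0 [Hx0 Hmin0]]; auto.
  { apply closure_closed. }
  { exists xx. apply closure_incl; auto. }
  set (m := - w x0).
  assert (Hm : 0 < m). { specialize (Hmin0 xx (closure_incl _ _ Hxx)). unfold m. lra. }
  assert (Hint : forall x, closure Sg x -> w x < 0 -> Sg x).
  { intros x Hx Hw. apply NNPP. intros HNS. specialize (Hbd x (conj Hx HNS)). lra. }
  (* All touching points will lie in [Gam], which is compact and contained in [Sg] because [w >= 0]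
     on the boundary. *)
  set (Gam := fun x => closure Sg x /\ w x <= - m / 2).
  assert (HGc : is_closed Gam).
  { intros x Hx.
    assert (Hxc : closure Sg x).
    { apply closure_closed. eapply closure_mono; [|exact Hx]. intros y [Hy _]; exact Hy. }
    split; auto. apply Rnot_lt_le. intros Hlt.
    destruct (Hcont x Hxc (w x + m / 2)) as [d [Hd H]]; [lra|].
    destruct (Hx d Hd) as [y [[Hy1 Hy2] Hn]]. specialize (H y Hy1 Hn). apply Rabs_def2 in H. lra. }
  assert (HGb : is_bounded Gam).
  { destruct Hcl as [b Hb]. exists b. intros x [Hx _]. auto. }
  assert (HCm : 0 < C * m) by nra.
  (* [r0] depends on [w] whereas [theta] must not; it only decides how fine the cubes have to be. *)
  assert (Hunif : exists r0, 0 < r0 /\ forall x y, Gam x -> near x y r0 ->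
    Sg y /\ forall k, W2 k y <= W2 k x + C * m).
  { apply NNPP. intros HNN.
    destruct (cluster_choice Gam (fun n x => exists y, near x y (/ (INR n + 1)) /\
      ~ (Sg y /\ forall k, W2 k y <= W2 k x + C * m)) HGb HGc) as [x [Hx Hclu]].
    { intros n. apply NNPP. intros HN2. apply HNN. exists (/ (INR n + 1)). split.
      { apply inv_INR_S_pos. }
      intros x y Hx Hn. apply NNPP. intros HN3. apply HN2. exists x. split; auto. exists y; auto. }
    assert (HSx : Sg x). { destruct Hx. apply Hint; auto. lra. }
    destruct (Hop x HSx) as [r1 [Hr1 Hball]].
    destruct (uniform_radius N (fun k r => forall y, Sg y -> near x y r -> Rabs (W2 k y - W2 k x) < C * m / 2))
      as [r2 [Hr2 Hc2]].
    { intros k r s Hq Hrs y Hy Hn. apply Hq; auto. eapply near_le; eauto. }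
    { intros k. destruct (HW2 k x HSx (C * m / 2)) as [d [Hd H]]; [lra|]. exists d; auto. }
    set (r := Rmin r1 r2). assert (Hr : 0 < r) by (apply Rmin_pos; auto).
    assert (r <= r1) by apply Rmin_l. assert (Hrr : r <= r2) by apply Rmin_r.
    destruct (inv_INR_S_small (r / 2)) as [n0 Hn0]; [lra|].
    destruct (Hclu (r / 2) n0) as [n [y [Hn [Hxy [_ [z [Hyz Hbad]]]]]]]; [lra|].
    assert (Hxz : near x z r).
    { replace r with (r / 2 + r / 2) by field. eapply near_trans; eauto.
      eapply near_le; [exact Hyz|]. left; auto. }
    assert (Hxy' : near x y r) by (eapply near_le; [exact Hxy | lra]).
    assert (Sy : Sg y) by (apply Hball; eapply near_le; eauto).
    assert (Sz : Sg z) by (apply Hball; eapply near_le; eauto).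
    apply Hbad. split; auto. intros k.
    pose proof (Hc2 k y Sy (near_le _ _ _ _ Hxy' Hrr)) as E1.
    pose proof (Hc2 k z Sz (near_le _ _ _ _ Hxz Hrr)) as E2.
    apply Rabs_def2 in E1. apply Rabs_def2 in E2. lra. }
  destruct Hunif as [r0 [Hr0 Hunif]].
  destruct (pow2_large (Rmax (2 * K) (2 * INR N / r0))) as [k1 Hk1].
  set (k := (k0 + k1)%nat).
  assert (Hpk : 0 < 2 ^ k) by apply pow2_pos.
  assert (Hk2 : Rmax (2 * K) (2 * INR N / r0) < 2 ^ k) by (apply Hk1; unfold k; lia).
  set (h := / 2 ^ k).
  assert (Hh : 0 < h) by (apply Rinv_0_lt_compat; auto).
  assert (Hh2 : 2 ^ k * h = 1) by (apply Rinv_r; lra).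
  assert (HhK : 2 * K < 2 ^ k) by (eapply Rle_lt_trans; [apply Rmax_l | exact Hk2]).
  assert (Hhr : 2 * INR N * h < r0).
  { assert (E : 2 * INR N / r0 < 2 ^ k) by (eapply Rle_lt_trans; [apply Rmax_r | exact Hk2]).
    apply (Rmult_lt_compat_l (r0 * h)) in E; [|nra].
    replace (r0 * h * (2 * INR N / r0)) with (2 * INR N * h) in E by (field; lra). nra. }
  (* Slopes touching in a common cube differ by at most [4 * (2 * (C * m)) * INR N * h]; 9 instead
     of 8 separates distinct grid slopes strictly. *)
  set (eta := 9 * (C * m) * INR N * h).
  assert (Heta : 0 < eta). { unfold eta. repeat apply Rmult_lt_0_compat; lra. }
  set (X := m / (8 * INR N * INR B) / eta).
  assert (HX : X = 2 * 2 ^ k / K).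
  { unfold X, eta, K, h. field. repeat split; lra. }
  assert (HX2 : 2 <= X).
  { rewrite HX. apply (Rmult_le_reg_r K); auto.
    replace (2 * 2 ^ k / K * K) with (2 * 2 ^ k) by (field; lra). lra. }
  destruct (nfloor_ex X) as [P HP]; [lra|].
  set (slope := fun (n : Fin.t N -> nat) => (fun i => eta * INR (n i)) : pt N).
  assert (Hslope : forall n, (forall i, (n i < P)%nat) ->
    forall i, Rabs (slope n i) <= m / (8 * INR N * INR B)).
  { intros n Hn i. unfold slope. specialize (Hn i). apply lt_INR in Hn. pose proof (pos_INR (n i)).
    rewrite Rabs_right by (apply Rle_ge, Rmult_le_pos; lra).
    replace (m / (8 * INR N * INR B)) with (eta * X) by (unfold X; field; repeat split; lra).
    apply Rmult_le_compat_l; lra. }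
  assert (Htouch : forall n : Fin.t N -> nat, exists xz : pt N * (Fin.t N -> nat),
    (forall i, (n i < P)%nat) ->
    Gam (fst xz) /\ cube B k (snd xz) (fst xz) /\
    forall y, closure Sg y -> w (fst xz) - dot (slope n) (fst xz) <= w y - dot (slope n) y).
  { intros n. destruct (classic (forall i, (n i < P)%nat)) as [Hn|Hn].
    (* Default value outside the grid, so that the choice function is total. *)
    2:{ exists (x0, n). intros; contradiction. }
    destruct (continuous_attains_min (closure Sg) (fun x => w x - dot (slope n) x)) as [x [Hx Hmin]]; auto.
    { apply closure_closed. }
    { apply continuous_on_minus; auto. apply dot_continuous. }
    { exists x0; auto. }
    destruct (cube_exists B k x) as [z Hz]; [apply closure_bounded with Sg; auto|].
    exists (x, z). intros _. simpl. split; [|split; auto]. split; auto.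
    specialize (Hmin x0 Hx0). cbv beta in Hmin.
    assert (Hd : Rabs (dot (slope n) (fun i => x i - x0 i)) <= INR N * (m / (8 * INR N * INR B) * (2 * INR B))).
    { apply dot_bound; [apply Hslope; auto|]. intros i.
      assert (H1 := closure_bounded Sg (INR B) Hbox x Hx i).
      assert (H2 := closure_bounded Sg (INR B) Hbox x0 Hx0 i).
      pose proof (Rabs_triang (x i) (- x0 i)). rewrite Rabs_Ropp in *. unfold Rminus. lra. }
    replace (INR N * (m / (8 * INR N * INR B) * (2 * INR B))) with (m / 4) in Hd by (field; lra).
    rewrite dot_minus_r in Hd. apply Rabs_le_bounds in Hd. unfold m in *. lra. }
  destruct (choice _ Htouch) as [XZ HXZ].
  assert (HGS : forall x, Gam x -> Sg x). { intros x [Hx1 Hx2]. apply Hint; auto. lra. }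
  assert (Hhess : forall n, (forall i, (n i < P)%nat) ->
    (forall i, W1 i (fst (XZ n)) = slope n i) /\
    forall y, near (fst (XZ n)) y r0 -> Sg y /\ forall i, W2 i y <= 2 * (C * m)).
  { intros n Hn. destruct (HXZ n Hn) as [HG [_ Hmin]]. set (x := fst (XZ n)) in *.
    assert (Sx := HGS x HG). destruct (Hop x Sx) as [r [Hr Hball]].
    assert (Hcrit := pure_C2_at_min Sg _ _ _ x r (pure_C2_lin Sg 1 w W1 W2 _ _ _ HC2 (dot_pure_C2 Sg (slope n))) Hr).
    destruct HG as [HG1 HG2].
    assert (Hcrit' : forall i, W1 i x - 1 * slope n i = 0 /\ 0 <= W2 i x - 1 * 0).
    { apply Hcrit. intros y Hy. split; auto. rewrite !Rmult_1_l. apply Hmin, closure_incl, Hball, Hy. }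
    split.
    { intros i. destruct (Hcrit' i). lra. }
    intros y Hy. destruct (Hunif x y (conj HG1 HG2) Hy) as [Sy HW]. split; auto. intros i.
    specialize (HW i).
    (* At a touching point all pure second derivatives are nonnegative, so each is at most the
       Laplacian, which is at most [- C * w x <= C * m]. *)
    assert (W2 i x <= C * m); [|lra].
    eapply Rle_trans; [apply (sumF_ge_term N (fun i => W2 i x))|].
    { intros j. destruct (Hcrit' j). lra. }
    eapply Rle_trans; [apply Hlap; auto; lra|].
    specialize (Hmin0 x HG1). unfold m. nra. }
  set (grid := product_list N (fun _ => seq 0 P)).
  assert (Hgrid : forall n, In n grid -> forall i, (n i < P)%nat).
  { intros n Hn i. unfold grid in Hn. rewrite in_product_list in Hn. specialize (Hn i).
    apply in_seq in Hn. lia. }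
  assert (Hcount : INR (length (map (fun n => snd (XZ n)) grid)) <= / 2 * (/ K) ^ N * (2 ^ k) ^ N).
  { apply (Hvol k); [unfold k; lia| |].
    - apply NoDup_map_NoDup_ForallPairs.
      2:{ apply NoDup_product_list. intros; apply seq_NoDup. }
      intros n n' Hn Hn' E. specialize (Hgrid n Hn) as Gn. specialize (Hgrid n' Hn') as Gn'.
      destruct (HXZ n Gn) as [G1 [c1 m1]]. destruct (HXZ n' Gn') as [G2 [c2 m2]].
      destruct (Hhess n Gn) as [s1 b1].
      apply functional_extensionality. intros i.
      assert (Hcl' := supporting_slopes_close Sg w W1 W2 (2 * (C * m)) h r0 (fst (XZ n)) (fst (XZ n'))
        (slope n) (slope n') HC2 ltac:(lra) Hh Hhr b1 s1
        (fun y Hy => m1 y (closure_incl _ _ Hy)) (fun y Hy => m2 y (closure_incl _ _ Hy))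
        (HGS _ G2)).
      rewrite <- E in c2. specialize (Hcl' (cube_near B k _ _ _ c1 c2) i).
      assert (Hlt : eta * Rabs (INR (n i) - INR (n' i)) < eta * 1).
      { rewrite <- (Rabs_right eta) at 1 by lra. rewrite <- Rabs_mult.
        replace (eta * (INR (n i) - INR (n' i))) with (slope n i - slope n' i) by (unfold slope; ring).
        eapply Rle_lt_trans; [exact Hcl'|]. unfold eta.
        assert (0 < C * m * INR N * h) by (repeat apply Rmult_lt_0_compat; lra). lra. }
      apply Rmult_lt_reg_l in Hlt; auto. apply Rabs_def2 in Hlt.
      destruct (Nat.lt_trichotomy (n i) (n' i)) as [Hc|[Hc|Hc]]; auto; exfalso;
        apply le_INR in Hc; rewrite S_INR in Hc; lra.
    - intros z Hz. apply in_map_iff in Hz. destruct Hz as [n [<- Hn]].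
      specialize (Hgrid n Hn). destruct (HXZ n Hgrid) as [G1 [c1 m1]].
      destruct (Hhess n Hgrid) as [_ b1]. split.
      + intros x Hx. apply b1. intros i. rewrite Rabs_minus_sym.
        eapply Rle_lt_trans; [apply (cube_near B k _ _ _ c1 Hx i)|]. fold h. nra.
      + exists (fst (XZ n)). split; auto. split; auto. destruct G1. lra. }
  rewrite length_map in Hcount. unfold grid in Hcount.
  rewrite (length_product_list N _ P) in Hcount by (intros; apply length_seq).
  rewrite pow_INR in Hcount.
  assert (Hlow : (/ K) ^ N * (2 ^ k) ^ N <= INR P ^ N).
  { rewrite <- Rpow_mult_distr. apply pow_incr.
    replace (/ K * 2 ^ k) with (X / 2) by (rewrite HX; field; lra). lra. }
  assert (0 < (/ K) ^ N * (2 ^ k) ^ N).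
  { apply Rmult_lt_0_compat; apply pow_lt; auto. apply Rinv_0_lt_compat; auto. }
  lra.
Qed.

(** * Moving planes *)

(** Coordinates are replaced one at a time: [y j] lies between [z j] and [- z j], and symmetry with
    convexity puts that whole segment in [Om]. *)
Lemma convex_symmetric_monotone {N} (Om : pt N -> Prop) :
  (forall i, convex_in_dir Om i) -> (forall i, symmetric_in_dir Om i) ->
  forall x y, Om x -> (forall k, Rabs (y k) <= Rabs (x k)) -> Om y.
Proof.
  intros Hc Hs x y Hx Hxy. apply (coordinatewise_ind Om x y Hx).
  intros z j Hz Hk. destruct (Hk j) as [E|E].
  - assert (H1 : Om (upd z j (z j))) by (rewrite upd_id; auto).
    assert (H2 : Om (upd z j (- z j))) by (apply Hs; auto).
    specialize (Hxy j). rewrite <- E in Hxy. apply Rabs_le_bounds in Hxy.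
    destruct (Rle_lt_dec 0 (z j)).
    + rewrite Rabs_right in Hxy by lra. apply (Hc j z (- z j) (z j)); auto.
    + rewrite Rabs_left in Hxy by lra. apply (Hc j z (z j) (- z j)); auto. lra.
  - rewrite <- E, upd_id. exact Hz.
Qed.

(** [E k] is the pure second derivative in direction [k], and [C] a Lipschitz constant of [f] on the
    values of [u]. The record is stable under reflection in [{x_i = 0}], so every later result also
    applies to the reflected solution. *)
Record solution {N} (Om : pt N -> Prop) (f : R -> R) (u : pt N -> R)
  (D1 E : Fin.t N -> pt N -> R) (C : R) : Prop := {
  sol_mono : forall x y, Om x -> (forall k, Rabs (y k) <= Rabs (x k)) -> Om y;
  sol_open : is_open Om;
  sol_bounded : is_bounded Om;
  sol_origin : Om origin;
  sol_lip_pos : 0 < C;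
  sol_lip : forall x y, Om x -> Om y -> Rabs (f (u x) - f (u y)) <= C * Rabs (u x - u y);
  sol_C2 : pure_C2 Om u D1 E;
  sol_cont2 : forall k, continuous_on Om (E k);
  sol_cont : continuous_on (closure Om) u;
  sol_eq : forall x, Om x -> - sumF N (fun k => E k x) = f (u x);
  sol_pos : forall x, Om x -> 0 < u x;
  sol_bd : forall x, boundary Om x -> u x = 0 }.

Definition refl {N} (i : Fin.t N) (lam : R) (x : pt N) : pt N := upd x i (2 * lam - x i).

Definition cap {N} (Om : pt N -> Prop) (i : Fin.t N) (lam : R) (x : pt N) : Prop :=
  Om x /\ lam < x i.

Definition refl_diff {N} (u : pt N -> R) (i : Fin.t N) (lam : R) (x : pt N) : R :=
  u (refl i lam x) - u x.

Lemma near_refl_map {N} i lam (x y : pt N) r : near x y r -> near (refl i lam x) (refl i lam y) r.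
Proof.
  intros H. apply near_upd; auto. specialize (H i).
  replace (2 * lam - y i - (2 * lam - x i)) with (- (y i - x i)) by ring. rewrite Rabs_Ropp. exact H.
Qed.

(** Sign produced by one differentiation through the reflection; it squares to 1, so pure second
    derivatives carry none. *)
Definition refl_sign {N} (i k : Fin.t N) : R := if Fin.eq_dec i k then -1 else 1.

Lemma refl_pure_C2 {N} (A B : pt N -> Prop) i lam g G1 G2 :
  pure_C2 B g G1 G2 -> (forall x, A x -> B (refl i lam x)) ->
  pure_C2 A (fun x => g (refl i lam x)) (fun k x => refl_sign i k * G1 k (refl i lam x))
    (fun k x => G2 k (refl i lam x)).
Proof.
  intros [H1 H2] HAB.
  assert (Haux : forall (v : pt N -> R) k x l, has_partial v k (refl i lam x) l ->
    has_partial (fun x => v (refl i lam x)) k x (refl_sign i k * l)).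
  { intros v k x l Hv. unfold has_partial, refl_sign. destruct (Fin.eq_dec i k) as [<-|E].
    - replace (-1 * l) with (l * (0 - 1)) by ring.
      replace (fun t => v (refl i lam (upd x i t))) with (fun t => v (upd x i (2 * lam - t))).
      + apply (derivable_pt_lim_comp (fun t => 2 * lam - t) (fun s => v (upd x i s))).
        * apply (derivable_pt_lim_minus (fun _ => 2 * lam) (fun t => t));
            [apply derivable_pt_lim_const | apply derivable_pt_lim_id].
        * apply has_partial_line. exact Hv.
      + apply functional_extensionality. intros t. unfold refl. rewrite upd_upd, upd_same. reflexivity.
    - rewrite Rmult_1_l. unfold has_partial in Hv. unfold refl in Hv at 2.
      rewrite upd_other in Hv by auto.
      replace (fun t => v (refl i lam (upd x k t))) with (fun t => v (upd (refl i lam x) k t)); auto.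
      apply functional_extensionality. intros t. unfold refl.
      rewrite (upd_other x k i) by auto. rewrite upd_comm by auto. reflexivity. }
  split; intros k x Hx.
  - apply Haux, H1, HAB, Hx.
  - assert (Hss : refl_sign i k * refl_sign i k = 1).
    { unfold refl_sign. destruct (Fin.eq_dec i k); ring. }
    replace (G2 k (refl i lam x)) with (refl_sign i k * (refl_sign i k * G2 k (refl i lam x))).
    + apply (derivable_pt_lim_scal (fun t => G1 k (refl i lam (upd x k t)))).
      apply (Haux (G1 k)). apply H2, HAB, Hx.
    + rewrite <- Rmult_assoc, Hss. ring.
Qed.

Lemma refl_continuous {N} (A B : pt N -> Prop) i lam g :
  continuous_on B g -> (forall x, A x -> B (refl i lam x)) ->
  continuous_on A (fun x => g (refl i lam x)).
Proof.
  intros Hg H x Hx eps He. destruct (Hg _ (H x Hx) eps He) as [d [Hd Hc]].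
  exists d. split; auto. intros y Hy Hn. apply Hc; auto. apply near_refl_map; auto.
Qed.

Lemma refl_closure {N} (A B : pt N -> Prop) i lam x :
  (forall y, A y -> B (refl i lam y)) -> closure A x -> closure B (refl i lam x).
Proof.
  intros H Hx r Hr. destruct (Hx r Hr) as [y [Hy Hn]].
  exists (refl i lam y). split; auto. apply near_refl_map; auto.
Qed.

Lemma refl_other {N} i lam (x : pt N) k : i <> k -> refl i lam x k = x k.
Proof. apply upd_other. Qed.

Lemma refl_same {N} i lam (x : pt N) : refl i lam x i = 2 * lam - x i.
Proof. apply upd_same. Qed.

Lemma refl_in {N} (Om : pt N -> Prop) f u D1 E C i lam x :
  solution Om f u D1 E C -> 0 <= lam -> cap Om i lam x -> Om (refl i lam x).
Proof.
  intros HS Hl [Hx Hxi]. apply (sol_mono _ _ _ _ _ _ HS x); auto. intros k.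
  destruct (Fin.eq_dec i k) as [<-|Hk]; [|rewrite refl_other by auto; lra].
  rewrite refl_same. rewrite (Rabs_right (x i)) by lra. apply Rabs_le. lra.
Qed.

Lemma refl_solution {N} (Om : pt N -> Prop) f u D1 E C i :
  solution Om f u D1 E C ->
  solution Om f (fun x => u (refl i 0 x)) (fun k x => refl_sign i k * D1 k (refl i 0 x))
    (fun k x => E k (refl i 0 x)) C.
Proof.
  intros HS.
  assert (HR : forall x, Om x -> Om (refl i 0 x)).
  { intros x Hx. apply (sol_mono _ _ _ _ _ _ HS x); auto. intros k.
    destruct (Fin.eq_dec i k) as [<-|Hk]; [|rewrite refl_other by auto; lra].
    rewrite refl_same. replace (2 * 0 - x i) with (- x i) by ring. rewrite Rabs_Ropp. lra. }
  assert (HRR : forall x : pt N, refl i 0 (refl i 0 x) = x).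
  { intros x. unfold refl. rewrite upd_upd, upd_same. rewrite <- (upd_id x i) at 3. f_equal. ring. }
  destruct HS. constructor; auto.
  - apply refl_pure_C2 with Om; auto.
  - intros k. apply refl_continuous with Om; auto.
  - apply refl_continuous with (closure Om); auto. intros x. apply refl_closure; auto.
  - intros x [Hx1 Hx2]. apply sol_bd0. split.
    + apply refl_closure with Om; auto.
    + intros Hc. apply Hx2. rewrite <- HRR. apply HR, Hc.
Qed.

Lemma solution_closure_nonneg {N} (Om : pt N -> Prop) f u D1 E C x :
  solution Om f u D1 E C -> closure Om x -> 0 <= u x.
Proof.
  intros HS Hx. destruct (classic (Om x)) as [H|H].
  - left. apply (sol_pos _ _ _ _ _ _ HS); auto.
  - right. symmetry. apply (sol_bd _ _ _ _ _ _ HS). split; auto.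
Qed.

Lemma cap_open {N} (Om : pt N -> Prop) i lam : is_open Om -> is_open (cap Om i lam).
Proof.
  intros H. apply open_and; auto. intros x Hx. exists (x i - lam). split; [lra|].
  intros y Hy. specialize (Hy i). apply Rabs_def2 in Hy. lra.
Qed.

Section RefDiff.

Context {N : nat} {Om : pt N -> Prop} {f : R -> R} {u : pt N -> R}
  {D1 E : Fin.t N -> pt N -> R} {C : R}.
Context (HS : solution Om f u D1 E C).

Lemma refl_diff_continuous i lam :
  0 <= lam -> continuous_on (closure (cap Om i lam)) (refl_diff u i lam).
Proof.
  intros Hl. apply continuous_on_minus.
  - apply refl_continuous with (closure Om); [apply (sol_cont _ _ _ _ _ _ HS)|].
    intros x. apply refl_closure. intros y. apply (refl_in _ _ _ _ _ _ _ _ _ HS Hl).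
  - apply continuous_on_subset with (closure Om); [|apply (sol_cont _ _ _ _ _ _ HS)].
    intros x. apply closure_mono. intros y [Hy _]. exact Hy.
Qed.

(** On the flat part [x i = lam] the reflection fixes [x]; on the rest [u x = 0], while the
    reflected point stays in the closure of [Om]. *)
Lemma refl_diff_boundary i lam x :
  0 <= lam -> boundary (cap Om i lam) x -> 0 <= refl_diff u i lam x.
Proof.
  intros Hl [Hx1 Hx2]. unfold refl_diff.
  assert (Hxc : closure Om x) by (eapply closure_mono; [|exact Hx1]; intros y [Hy _]; exact Hy).
  destruct (classic (Om x)) as [H|H].
  - assert (lam <= x i).
    { apply closure_bounded_coord_below with (A := cap Om i lam); auto. intros y [_ Hy]. lra. }
    assert (x i = lam).
    { destruct (Req_dec (x i) lam); auto. exfalso. apply Hx2. split; auto. lra. }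
    unfold refl. replace (2 * lam - x i) with (x i) by lra. rewrite upd_id. lra.
  - rewrite (sol_bd _ _ _ _ _ _ HS x) by (split; auto).
    assert (0 <= u (refl i lam x)); [|lra]. apply (solution_closure_nonneg _ _ _ _ _ _ _ HS).
    apply refl_closure with (cap Om i lam); auto. intros y. apply (refl_in _ _ _ _ _ _ _ _ _ HS Hl).
Qed.

Definition refl_diff1 i lam k x := refl_sign i k * D1 k (refl i lam x) - 1 * D1 k x.
Definition refl_diff2 i lam k x := E k (refl i lam x) - 1 * E k x.

Lemma refl_diff_pure_C2 i lam :
  0 <= lam -> pure_C2 (cap Om i lam) (refl_diff u i lam) (refl_diff1 i lam) (refl_diff2 i lam).
Proof.
  intros Hl.
  replace (refl_diff u i lam) with (fun x => u (refl i lam x) - 1 * u x).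
  - apply (pure_C2_lin (cap Om i lam) 1 (fun x => u (refl i lam x))
      (fun k x => refl_sign i k * D1 k (refl i lam x)) (fun k x => E k (refl i lam x)) u D1 E).
    + apply refl_pure_C2 with Om; [apply (sol_C2 _ _ _ _ _ _ HS)|].
      intros x. apply (refl_in _ _ _ _ _ _ _ _ _ HS Hl).
    + apply pure_C2_subset with Om; [intros x [Hx _]; auto | apply (sol_C2 _ _ _ _ _ _ HS)].
  - apply functional_extensionality. intros x. unfold refl_diff. ring.
Qed.

Lemma refl_diff2_continuous i lam k :
  0 <= lam -> continuous_on (cap Om i lam) (refl_diff2 i lam k).
Proof.
  intros Hl. apply continuous_on_minus.
  - apply refl_continuous with Om; [apply (sol_cont2 _ _ _ _ _ _ HS)|].
    intros x. apply (refl_in _ _ _ _ _ _ _ _ _ HS Hl).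
  - apply continuous_on_scal. apply continuous_on_subset with Om; [intros x [Hx _]; auto|].
    apply (sol_cont2 _ _ _ _ _ _ HS).
Qed.

(** Stated with an absolute value to serve both signs: nonnegative values for the tube barrier,
    negative ones for the maximum principle. *)
Lemma refl_diff_laplacian i lam x :
  0 <= lam -> cap Om i lam x ->
  sumF N (fun k => refl_diff2 i lam k x) <= C * Rabs (refl_diff u i lam x).
Proof.
  intros Hl Hx. assert (Hr := refl_in _ _ _ _ _ _ _ _ _ HS Hl Hx). destruct Hx as [Hx _].
  unfold refl_diff2.
  rewrite (sumF_ext N _ (fun k => E k (refl i lam x) + (-1) * E k x)) by (intros; ring).
  rewrite sumF_lin.
  pose proof (sol_eq _ _ _ _ _ _ HS x Hx). pose proof (sol_eq _ _ _ _ _ _ HS _ Hr).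
  pose proof (sol_lip _ _ _ _ _ _ HS _ _ Hr Hx) as L.
  pose proof (Rle_abs (- (f (u (refl i lam x)) - f (u x)))). rewrite Rabs_Ropp in *.
  unfold refl_diff. lra.
Qed.

(** The sign condition on [c] says that it lies between [z j] and [t], in either order. The radius
    is uniform because the segment is compact. *)
Lemma segment_neighbourhood (A : pt N -> Prop) z j t :
  is_open A -> (forall c, (c - z j) * (c - t) <= 0 -> A (upd z j c)) ->
  exists r, 0 < r /\ forall c y, (c - z j) * (c - t) <= 0 -> near (upd z j c) y r -> A y.
Proof.
  intros HA Hseg. set (lo := Rmin (z j) t). set (hi := Rmax (z j) t).
  assert (Hbt : forall c, (c - z j) * (c - t) <= 0 <-> lo <= c <= hi).
  { intros c. unfold lo, hi, Rmin, Rmax. destruct (Rle_dec (z j) t); split; intros H; nra. }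
  set (Sg := fun x : pt N => (forall k, j <> k -> x k = z k) /\ lo <= x j <= hi).
  assert (HSg : forall x, Sg x -> x = upd z j (x j)).
  { intros x [H1 H2]. apply functional_extensionality. intros k.
    unfold upd. destruct (Fin.eq_dec j k) as [<-|]; auto. }
  assert (Hc : is_closed Sg).
  { intros x Hx. split; [intros k Hk; apply Rle_antisym|split].
    - apply (closure_bounded_coord Sg k (z k)); auto. intros y [Hy _]. rewrite Hy by auto. lra.
    - apply (closure_bounded_coord_below Sg k (z k)); auto. intros y [Hy _]. rewrite Hy by auto. lra.
    - apply (closure_bounded_coord_below Sg j lo); auto. intros y [_ Hy]. lra.
    - apply (closure_bounded_coord Sg j hi); auto. intros y [_ Hy]. lra. }
  assert (Hb : is_bounded Sg).
  { destruct (argmax_F N (fun k => Rabs (z k)) j) as [m Hm].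
    exists (Rabs (z m) + Rabs lo + Rabs hi). intros x [H1 H2] i. specialize (Hm i). cbv beta in Hm.
    pose proof (Rabs_pos (z m)). pose proof (Rabs_pos lo). pose proof (Rabs_pos hi).
    destruct (Fin.eq_dec j i) as [<-|Hi]; [|rewrite H1 by auto; lra].
    pose proof (Rle_abs hi). pose proof (Rle_abs (- lo)). rewrite (Rabs_Ropp lo) in *.
    apply Rabs_le. lra. }
  apply NNPP. intros HN.
  destruct (cluster_choice Sg (fun n x => exists y, near x y (/ (INR n + 1)) /\ ~ A y) Hb Hc)
    as [x [Hx Hcl]].
  { intros n. apply NNPP. intros HN2. apply HN. exists (/ (INR n + 1)). split.
    { apply inv_INR_S_pos. }
    intros c y Hcb Hn. apply NNPP. intros Hy. apply HN2. exists (upd z j c). split.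
    - split; [intros k Hk; apply upd_other; auto|]. rewrite upd_same. apply Hbt; auto.
    - exists y; auto. }
  assert (HAx : A x).
  { rewrite (HSg x Hx). apply Hseg. apply Hbt. apply Hx. }
  destruct (HA x HAx) as [r [Hr Hball]].
  destruct (inv_INR_S_small (r / 2)) as [n0 Hn0]; [lra|].
  destruct (Hcl (r / 2) n0) as [n [y [Hn [Hxy [_ [v [Hyv Hv]]]]]]]; [lra|].
  apply Hv, Hball. replace r with (r / 2 + r / 2) by field. eapply near_trans; [exact Hxy|].
  eapply near_le; [exact Hyv|]. left; auto.
Qed.

Lemma tube_near (z : pt N) j sg tau L rho x k :
  0 < rho -> tube z j sg tau L rho x -> j <> k -> Rabs (x k - z k) <= rho.
Proof.
  intros Hr [_ H] Hk. pose proof (dist2_off_ge z j x k Hk) as Hd.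
  rewrite <- (Rabs_right rho) by lra. apply Rsqr_le_abs_0. unfold Rsqr. lra.
Qed.

(** A thin tube around the segment, with its top through [z], where the difference is at least half
    its value at [z]. The tube is prolonged by [rho] beyond [t], so that the target sits at height
    [rho], where the barrier is positive. *)
Lemma positivity_propagates i lam z j t :
  0 <= lam -> (forall x, cap Om i lam x -> 0 <= refl_diff u i lam x) ->
  cap Om i lam z -> 0 < refl_diff u i lam z -> cap Om i lam (upd z j t) ->
  0 < refl_diff u i lam (upd z j t).
Proof.
  intros Hl Hw Hz Hwz Ht.
  destruct (Req_dec t (z j)) as [->|Hne]; [rewrite upd_id; auto|].
  assert (Hseg : forall c, (c - z j) * (c - t) <= 0 -> cap Om i lam (upd z j c)).
  { intros c Hc. destruct Hz as [Hz1 Hz2], Ht as [Ht1 Ht2]. split.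
    - assert (Hor : Rabs c <= Rabs (z j) \/ Rabs c <= Rabs t).
      { unfold Rabs. destruct (Rcase_abs c), (Rcase_abs (z j)), (Rcase_abs t);
          destruct (Rle_lt_dec (z j) t); try (left; nra); try (right; nra). }
      destruct Hor as [Ho|Ho].
      + apply (sol_mono _ _ _ _ _ _ HS z); auto. intros k. unfold upd.
        destruct (Fin.eq_dec j k) as [<-|]; lra.
      + apply (sol_mono _ _ _ _ _ _ HS (upd z j t)); auto. intros k. unfold upd.
        destruct (Fin.eq_dec j k) as [<-|]; lra.
    - unfold upd in *. destruct (Fin.eq_dec j i) as [<-|]; auto. nra. }
  destruct (segment_neighbourhood _ z j t (cap_open Om i lam (sol_open _ _ _ _ _ _ HS)) Hseg)
    as [r [Hr Hball]].
  assert (Hcz := closure_incl _ _ Hz).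
  destruct (refl_diff_continuous i lam Hl z Hcz (refl_diff u i lam z / 2)) as [d [Hd Hcont]]; [lra|].
  set (rho := Rmin r d / 2).
  assert (Hm : 0 < Rmin r d) by (apply Rmin_pos; auto).
  assert (Hr1 := Rmin_l r d). assert (Hr2 := Rmin_r r d).
  assert (Hrho : 0 < rho) by (unfold rho; lra).
  assert (Hsg : exists sg, sg * sg = 1 /\ 0 < sg * (z j - t)).
  { destruct (Rlt_le_dec t (z j)); [exists 1 | exists (-1)]; lra. }
  destruct Hsg as [sg [Hsg1 Hsg2]].
  set (tau := t - sg * rho). set (L := sg * (z j - t) + rho).
  assert (Esg : sg = 1 \/ sg = -1).
  { assert (E0 : (sg - 1) * (sg + 1) = 0) by lra. apply Rmult_integral in E0. lra. }
  assert (Htube : forall x, tube z j sg tau L rho x -> cap Om i lam x).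
  { intros x Hx. assert (Hxk := fun k => tube_near z j sg tau L rho x k Hrho Hx).
    destruct Hx as [Hxj _].
    assert (Hc : exists c, (c - z j) * (c - t) <= 0 /\ Rabs (x j - c) <= rho).
    { unfold tau, L in Hxj.
      destruct (Rle_lt_dec 0 (sg * (x j - t))) as [Hp|Hp].
      - exists (x j). rewrite Rminus_diag, Rabs_R0. split; [|lra].
        destruct Esg as [-> | ->]; nra.
      - exists t. split; [rewrite Rminus_diag; lra|]. apply Rabs_le. destruct Esg as [-> | ->]; lra. }
    destruct Hc as [c [Hc1 Hc2]]. apply (Hball c x Hc1).
    intros k. unfold upd. destruct (Fin.eq_dec j k) as [<-|Hk].
    - unfold rho in *; lra.
    - specialize (Hxk k Hk). unfold rho in *; lra. }
  pose proof (tube_lower_bound z j sg tau L rho C (refl_diff u i lam z / 2)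
    (refl_diff u i lam) (refl_diff1 i lam) (refl_diff2 i lam) Hsg1 Hrho (sol_lip_pos _ _ _ _ _ _ HS)) as T.
  assert (Hint : forall x, tube_int z j sg tau L rho x -> cap Om i lam x).
  { intros x [Hx1 Hx2]. apply Htube. split; lra. }
  specialize (T ltac:(lra)).
  specialize (T (continuous_on_subset _ _ _ (fun x Hx => closure_incl _ _ (Htube x Hx))
    (refl_diff_continuous i lam Hl))).
  specialize (T (fun x Hx => Hw x (Htube x Hx))).
  assert (T1 : forall x, tube z j sg tau L rho x -> sg * (x j - tau) = L ->
    refl_diff u i lam z / 2 <= refl_diff u i lam x).
  { intros x Hx Htop.
    assert (Exj : x j = z j) by (unfold tau, L in Htop; destruct Esg as [-> | ->]; lra).
    assert (Hn : near z x d).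
    { intros k. destruct (Fin.eq_dec j k) as [<-|Hk].
      - rewrite Exj, Rminus_diag, Rabs_R0. exact Hd.
      - pose proof (tube_near z j sg tau L rho x k Hrho Hx Hk). unfold rho in *; lra. }
    specialize (Hcont x (closure_incl _ _ (Htube x Hx)) Hn). apply Rabs_def2 in Hcont. lra. }
  specialize (T T1 (pure_C2_subset _ _ _ _ _ Hint (refl_diff_pure_C2 i lam Hl))).
  assert (T2 : forall x, tube_int z j sg tau L rho x ->
    sumF N (fun k => refl_diff2 i lam k x) <= C * refl_diff u i lam x).
  { intros x Hx. pose proof (refl_diff_laplacian i lam x Hl (Hint x Hx)) as Hlap.
    rewrite Rabs_right in Hlap; auto. apply Rle_ge, Hw, Hint, Hx. }
  specialize (T T2 rho ltac:(unfold L; lra)).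
  replace (tau + sg * rho) with t in T by (unfold tau; ring).
  eapply Rlt_le_trans; [|exact T].
  pose proof (tube_rate_pos N C rho (sol_lip_pos _ _ _ _ _ _ HS) Hrho) as Hb.
  apply Rmult_lt_0_compat; [apply Rmult_lt_0_compat; [lra | apply exp_pos]|].
  assert (1 < exp (tube_rate N C rho * rho)); [|lra].
  rewrite <- exp_0. apply exp_increasing. apply Rmult_lt_0_compat; auto.
Qed.

(** [b] is the supremum of [Rabs (x i)] over [Om]. Projecting a point onto the axis keeps it in
    [Om], so the axis reaches as far as [Om] does; openness makes the first bound strict. *)
Lemma axis_extent i :
  exists b, 0 < b /\ (forall x, Om x -> Rabs (x i) < b) /\ (forall t, Rabs t < b -> Om (upd origin i t)).
Proof.
  destruct (sol_bounded _ _ _ _ _ _ HS) as [M HM].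
  destruct (completeness (fun v => exists x, Om x /\ v = Rabs (x i))) as [b [Hb1 Hb2]].
  { exists M. intros v [x [Hx ->]]. apply HM; auto. }
  { exists (Rabs (@origin N i)). exists origin. split; auto. apply (sol_origin _ _ _ _ _ _ HS). }
  assert (Hlt : forall x, Om x -> Rabs (x i) < b).
  { intros x Hx. destruct (sol_open _ _ _ _ _ _ HS x Hx) as [r [Hr Hball]].
    assert (Hs : exists s, Rabs s = r / 2 /\ Rabs (x i + s) = Rabs (x i) + r / 2).
    { destruct (Rle_lt_dec 0 (x i)).
      - exists (r / 2). rewrite !Rabs_right by lra. lra.
      - exists (- (r / 2)). rewrite Rabs_Ropp, (Rabs_right (r / 2)), (Rabs_left (x i)), Rabs_left by lra. lra. }
    destruct Hs as [s [Hs1 Hs2]].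
    assert (Hy : Om (upd x i (x i + s))).
    { apply Hball, near_upd_self. replace (x i + s - x i) with s by ring. lra. }
    assert (Rabs (x i) + r / 2 <= b); [|lra].
    apply Hb1. eexists; split; [exact Hy|]. rewrite upd_same. auto. }
  exists b. split; [|split; auto].
  - eapply Rle_lt_trans; [apply Rabs_pos | apply (Hlt _ (sol_origin _ _ _ _ _ _ HS))].
  - intros t Ht. assert (Hx : exists x, Om x /\ Rabs t < Rabs (x i)).
    { apply NNPP. intros HN. assert (b <= Rabs t); [|lra]. apply Hb2. intros v [x [Hx ->]].
      apply Rnot_lt_le. intros Hlt'. apply HN. exists x; auto. }
    destruct Hx as [x [Hx Htx]]. apply (sol_mono _ _ _ _ _ _ HS x); auto. intros k.
    unfold upd. destruct (Fin.eq_dec i k) as [<-|]; [lra|].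
    unfold origin. rewrite Rabs_R0. apply Rabs_pos.
Qed.

Lemma axis_end_boundary i b :
  0 < b -> (forall x, Om x -> Rabs (x i) < b) -> (forall t, Rabs t < b -> Om (upd origin i t)) ->
  boundary Om (upd origin i b).
Proof.
  intros Hb Hlt Hax. split.
  - intros r Hr. pose proof (Rmin_l r b). pose proof (Rmin_r r b).
    assert (0 < Rmin r b) by (apply Rmin_pos; auto).
    exists (upd origin i (b - Rmin r b / 2)). split.
    + apply Hax. rewrite Rabs_right; lra.
    + apply near_upd; [apply near_refl; auto|].
      replace (b - Rmin r b / 2 - b) with (- (Rmin r b / 2)) by ring.
      rewrite Rabs_Ropp, Rabs_right; lra.
  - intros Hx. specialize (Hlt _ Hx). rewrite upd_same, Rabs_right in Hlt; lra.
Qed.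

(** Positivity starts near the end of the axis, where [u] is close to 0 while the reflected point is
    interior since [0 < lam < b]. It then travels along the axis to height [x i], and from there to
    [x] one coordinate at a time; all these points are in the cap by monotonicity. *)
Lemma refl_diff_strictly_positive i lam :
  0 < lam -> (forall x, cap Om i lam x -> 0 <= refl_diff u i lam x) ->
  forall x, cap Om i lam x -> 0 < refl_diff u i lam x.
Proof.
  intros Hl Hw x Hx. destruct (axis_extent i) as [b [Hb [Hlt Hax]]].
  assert (Hbd := axis_end_boundary i b Hb Hlt Hax).
  assert (Hlb : lam < b).
  { destruct Hx as [Hx1 Hx2]. specialize (Hlt x Hx1). pose proof (Rle_abs (x i)). lra. }
  assert (Hrb : Om (refl i lam (upd origin i b))).
  { unfold refl. rewrite upd_upd, upd_same. apply Hax. apply Rabs_def1; lra. }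
  assert (Hc := sol_pos _ _ _ _ _ _ HS _ Hrb).
  set (c := u (refl i lam (upd origin i b))) in *.
  assert (Hub := sol_bd _ _ _ _ _ _ HS _ Hbd).
  destruct (sol_cont _ _ _ _ _ _ HS _ (proj1 Hbd) (c / 2)) as [d1 [Hd1 Hc1]]; [lra|].
  destruct (sol_cont _ _ _ _ _ _ HS _ (closure_incl _ _ Hrb) (c / 2)) as [d2 [Hd2 Hc2]]; [lra|].
  set (d := Rmin (Rmin d1 d2) (b - lam)).
  assert (Hd : 0 < d) by (repeat apply Rmin_pos; lra).
  assert (d <= b - lam) by apply Rmin_r.
  assert (Hdd : d <= Rmin d1 d2) by apply Rmin_l.
  assert (Hle1 : d <= d1) by (eapply Rle_trans; [exact Hdd | apply Rmin_l]).
  assert (Hle2 : d <= d2) by (eapply Rle_trans; [exact Hdd | apply Rmin_r]).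
  set (t1 := b - d / 2).
  assert (Hn : near (upd (@origin N) i b) (upd origin i t1) d).
  { apply near_upd; [apply near_refl; auto|]. unfold t1.
    replace (b - d / 2 - b) with (- (d / 2)) by ring. rewrite Rabs_Ropp, Rabs_right; lra. }
  assert (Hy : cap Om i lam (upd origin i t1)).
  { split; [|rewrite upd_same; unfold t1; lra]. apply Hax. rewrite Rabs_right; unfold t1; lra. }
  assert (Hwy : 0 < refl_diff u i lam (upd origin i t1)).
  { assert (Hry := refl_in _ _ _ _ _ _ _ _ _ HS (Rlt_le _ _ Hl) Hy). destruct Hy as [Hy _].
    specialize (Hc1 _ (closure_incl _ _ Hy) (near_le _ _ _ _ Hn Hle1)).
    specialize (Hc2 _ (closure_incl _ _ Hry) (near_le _ _ _ _ (near_refl_map i lam _ _ _ Hn) Hle2)).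
    fold c in Hc2. apply Rabs_def2 in Hc1. apply Rabs_def2 in Hc2. unfold refl_diff. lra. }
  destruct Hx as [Hx1 Hx2].
  assert (Hmono : forall z, (forall k, z k = upd origin i (x i) k \/ z k = x k) -> cap Om i lam z).
  { intros z Hz. split.
    - apply (sol_mono _ _ _ _ _ _ HS x); auto. intros k. destruct (Hz k) as [-> | ->]; [|lra].
      unfold upd. destruct (Fin.eq_dec i k) as [<-|]; [lra|]. unfold origin. rewrite Rabs_R0. apply Rabs_pos.
    - destruct (Hz i) as [-> | ->]; auto. rewrite upd_same; auto. }
  apply (coordinatewise_ind (fun z => 0 < refl_diff u i lam z) (upd origin i (x i)) x).
  - rewrite <- (upd_upd origin i t1). apply positivity_propagates; auto; [lra|].
    rewrite upd_upd. apply Hmono. intros k; left; reflexivity.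
  - intros z j Hz Hk. apply positivity_propagates; auto; [lra|].
    apply Hmono. intros k. unfold upd at 1 3. destruct (Fin.eq_dec j k) as [<-|]; auto.
Qed.

(** A fixed [x] stays in the cap while [mu < x i], and its reflection moves continuously. Used at
    the critical position of the plane and at [lam = 0]. *)
Lemma refl_diff_right_limit i lam x :
  0 <= lam -> cap Om i lam x ->
  (forall mu y, lam < mu -> cap Om i mu y -> 0 <= refl_diff u i mu y) -> 0 <= refl_diff u i lam x.
Proof.
  intros Hl Hx H. apply Rnot_lt_le. intros Hneg.
  assert (Hr := refl_in _ _ _ _ _ _ _ _ _ HS Hl Hx).
  destruct (sol_cont _ _ _ _ _ _ HS _ (closure_incl _ _ Hr) (- refl_diff u i lam x)) as [d [Hd Hc]]; [lra|].
  destruct Hx as [Hx1 Hx2].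
  set (e := Rmin d (x i - lam)). assert (He : 0 < e) by (apply Rmin_pos; lra).
  assert (e <= d) by apply Rmin_l. assert (e <= x i - lam) by apply Rmin_r.
  assert (Hmu : cap Om i (lam + e / 4) x) by (split; auto; lra).
  assert (Hle : 0 <= lam + e / 4) by lra.
  assert (Hr2 := refl_in _ _ _ _ _ _ _ _ _ HS Hle Hmu).
  specialize (H (lam + e / 4) x ltac:(lra) Hmu).
  specialize (Hc _ (closure_incl _ _ Hr2)). unfold refl_diff in *.
  assert (Hn : near (refl i lam x) (refl i (lam + e / 4) x) d).
  { apply near_upd; [apply near_refl; auto|].
    replace (2 * (lam + e / 4) - x i - (2 * lam - x i)) with (e / 2) by field. rewrite Rabs_right; lra. }
  specialize (Hc Hn). apply Rabs_def2 in Hc. lra.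
Qed.

Lemma refl_diff_stable_on_compact i s (K : pt N -> Prop) :
  0 < s -> is_bounded K -> is_closed K -> (forall x, K x -> cap Om i s x) ->
  (forall x, K x -> 0 < refl_diff u i s x) ->
  exists d, 0 < d /\ forall lam x, 0 < lam -> s - d < lam <= s -> K x -> 0 <= refl_diff u i lam x.
Proof.
  intros Hs HKb HKc HK Hpos. apply NNPP. intros HN.
  destruct (cluster_choice K (fun n x => exists lam, 0 < lam /\ s - / (INR n + 1) < lam <= s /\
    refl_diff u i lam x < 0) HKb HKc) as [x [Hx Hcl]].
  { intros n. apply NNPP. intros HN2. apply HN. exists (/ (INR n + 1)). split; [apply inv_INR_S_pos|].
    intros lam x Hl Hls Hx. apply Rnot_lt_le. intros Hneg. apply HN2. exists x. split; auto.
    exists lam; auto. }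
  assert (Hcx := HK x Hx). assert (Hw := Hpos x Hx).
  assert (Hr := refl_in _ _ _ _ _ _ _ _ _ HS (Rlt_le _ _ Hs) Hcx).
  set (c := refl_diff u i s x) in *.
  destruct (sol_cont _ _ _ _ _ _ HS _ (closure_incl _ _ (proj1 Hcx)) (c / 2)) as [d1 [Hd1 Hc1]]; [lra|].
  destruct (sol_cont _ _ _ _ _ _ HS _ (closure_incl _ _ Hr) (c / 2)) as [d2 [Hd2 Hc2]]; [lra|].
  set (d := Rmin d1 d2). assert (Hd : 0 < d) by (apply Rmin_pos; auto).
  assert (Hdd1 : d <= d1) by apply Rmin_l. assert (Hdd2 : d / 2 + d / 2 <= d2) by (pose proof (Rmin_r d1 d2); unfold d; lra).
  destruct (inv_INR_S_small (d / 4)) as [n0 Hn0]; [lra|].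
  destruct (Hcl (d / 2) n0) as [n [y [Hn [Hxy [Hy [lam [Hl [Hls Hneg]]]]]]]]; [lra|].
  specialize (Hn0 n Hn). assert (Hcy := HK y Hy).
  assert (Hcy' : cap Om i lam y) by (destruct Hcy; split; auto; lra).
  assert (Hry := refl_in _ _ _ _ _ _ _ _ _ HS (Rlt_le _ _ Hl) Hcy').
  assert (Hxy1 : near x y d1) by (eapply near_le; [exact Hxy | lra]).
  specialize (Hc1 y (closure_incl _ _ (proj1 Hcy)) Hxy1).
  assert (Hn2 : near (refl i s x) (refl i lam y) d2).
  { eapply near_le; [|exact Hdd2].
    apply near_trans with (refl i s y); [apply near_refl_map; auto|].
    apply near_upd; [apply near_refl; lra|]. apply Rabs_def1; lra. }
  specialize (Hc2 _ (closure_incl _ _ Hry) Hn2).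
  apply Rabs_def2 in Hc1. apply Rabs_def2 in Hc2. unfold c, refl_diff in *. lra.
Qed.

End RefDiff.

Lemma cube_closed {N} B k (z : Fin.t N -> nat) : is_closed (cube B k z).
Proof.
  intros x Hx i. split.
  - apply Rnot_lt_le. intros Hlt.
    assert (H : is_closed (fun x : pt N => - 2 ^ k * (x i - - INR B) <= - INR (z i))).
    { apply closed_sublevel, affine_coord_continuous. }
    specialize (H x). cbv beta in H. apply (Rlt_not_le _ _ Hlt).
    assert (- 2 ^ k * (x i - - INR B) <= - INR (z i)); [|lra].
    apply H. eapply closure_mono; [|exact Hx]. intros y Hy. specialize (Hy i). cbv beta. lra.
  - apply Rnot_lt_le. intros Hlt.
    assert (H : is_closed (fun x : pt N => 2 ^ k * (x i - - INR B) <= INR (z i) + 1)).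
    { apply closed_sublevel, affine_coord_continuous. }
    specialize (H x). cbv beta in H. apply (Rlt_not_le _ _ Hlt).
    assert (2 ^ k * (x i - - INR B) <= INR (z i) + 1); [|lra].
    apply H. eapply closure_mono; [|exact Hx]. intros y Hy. specialize (Hy i). cbv beta. lra.
Qed.

Lemma closed_finite_union {N} {T : Type} (l : list T) (A : T -> pt N -> Prop) :
  (forall t, is_closed (A t)) -> is_closed (fun x => exists t, In t l /\ A t x).
Proof.
  intros HA x. induction l as [|t l IH]; intros Hx.
  - destruct (Hx 1 Rlt_0_1) as [y [[t [[] _]] _]].
  - apply NNPP. intros HN.
    assert (H1 : ~ closure (A t) x).
    { intros H. apply HN. exists t. split; [left; auto|]. apply HA; auto. }
    assert (H2 : ~ closure (fun x => exists t, In t l /\ A t x) x).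
    { intros H. apply HN. destruct (IH H) as [t' [Ht' Hx']]. exists t'. split; [right|]; auto. }
    assert (Hsep : forall P : pt N -> Prop, ~ closure P x -> exists r, 0 < r /\ forall y, P y -> ~ near x y r).
    { intros P HP. apply NNPP. intros HN2. apply HP. intros r Hr. apply NNPP. intros HN3. apply HN2.
      exists r. split; auto. intros y Hy Hn. apply HN3. exists y; auto. }
    destruct (Hsep _ H1) as [r1 [Hr1 Hs1]]. destruct (Hsep _ H2) as [r2 [Hr2 Hs2]].
    destruct (Hx (Rmin r1 r2)) as [y [[t' [[<-|Ht'] Hy]] Hn]]; [apply Rmin_pos; auto| |].
    + apply (Hs1 y Hy). eapply near_le; [exact Hn | apply Rmin_l].
    + apply (Hs2 y); [exists t'; auto|]. eapply near_le; [exact Hn | apply Rmin_r].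
Qed.

(* For [lam] slightly below [s], the set where [refl_diff u i lam < 0] avoids a compact [K]
   filling almost all of the cap at [s], so up to a thin slab its volume is small. *)
Lemma moving_planes_step {N} (Om : pt N -> Prop) f u D1 E C (i : Fin.t N) s :
  solution Om f u D1 E C -> 0 < s ->
  (forall x, cap Om i s x -> 0 < refl_diff u i s x) ->
  exists d, 0 < d /\ forall lam x, 0 < lam -> s - d < lam <= s -> cap Om i lam x ->
    0 <= refl_diff u i lam x.
Proof.
  intros HS Hs Hpos.
  assert (HN : (1 <= N)%nat).
  { destruct N; [apply (Fin.case0 (fun _ => _) i) | lia]. }
  destruct (sol_bounded _ _ _ _ _ _ HS) as [M HM].
  destruct (INR_unbounded M) as [B0 HB0]. set (B := S B0).
  assert (HMB : forall x, Om x -> forall k, Rabs (x k) <= INR B).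
  { intros x Hx k. specialize (HM x Hx k). unfold B. rewrite S_INR. lra. }
  assert (HB1 : (1 <= B)%nat) by (unfold B; lia).
  destruct (maximum_principle_small_volume N B C HN HB1 (sol_lip_pos _ _ _ _ _ _ HS)) as [theta [Hth HMP]].
  destruct (inner_dyadic_approximation (cap Om i s) B (theta / 2)) as [k1 [l0 [Hl0 Hin]]]; [|lra|].
  { intros x [Hx _]. apply HMB; auto. }
  destruct (thin_slab_count N B (theta / 2)) as [d1 [k2 [Hd1 Hslab]]]; [auto|lra|].
  set (K := fun x => exists z, In z l0 /\ cube B k1 z x).
  assert (HK : forall x, K x -> cap Om i s x). { intros x [z [Hz Hx]]. apply (Hl0 z); auto. }
  destruct (refl_diff_stable_on_compact HS i s K Hs) as [d2 [Hd2 Hst]]; auto.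
  { exists (INR B). intros x Hx. destruct (HK x Hx) as [Hx' _]. apply HMB; auto. }
  { apply closed_finite_union. intros z. apply cube_closed. }
  exists (Rmin d1 d2). split; [apply Rmin_pos; auto|].
  intros lam x Hl Hls. pose proof (Rmin_l d1 d2). pose proof (Rmin_r d1 d2).
  revert x. assert (Hl0' : 0 <= lam) by lra.
  apply (HMP (cap Om i lam) (refl_diff u i lam) (@refl_diff1 N D1 i lam) (@refl_diff2 N E i lam)).
  - apply cap_open, (sol_open _ _ _ _ _ _ HS).
  - intros x [Hx _]. apply HMB; auto.
  - apply (refl_diff_continuous HS); auto.
  - intros x. apply (refl_diff_boundary HS); auto.
  - apply (refl_diff_pure_C2 HS); auto.
  - intros k. apply (refl_diff2_continuous HS); auto.
  - intros x Hx Hneg. pose proof (refl_diff_laplacian HS i lam x Hl0' Hx) as Hlap.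
    rewrite Rabs_left in Hlap by auto. lra.
  - exists (k1 + k2)%nat. intros k l Hk Hl' Hz.
    (* A cube inside the cap at [s] contains a point outside [K], since the difference is
       nonnegative on [K]; any other cube meets the slab between [lam] and [s]. Each family gets
       half of [theta]. *)
    set (P := fun z => if excluded_middle_informative (forall x, cube B k z x -> cap Om i s x) then true else false).
    rewrite <- (filter_length P l), plus_INR.
    assert (H1 : INR (length (filter P l)) <= theta / 2 * (2 ^ k) ^ N).
    { apply Hin; [lia | apply NoDup_filter; auto |]. intros z Hzin. apply filter_In in Hzin.
      destruct Hzin as [Hzl HPz]. unfold P in HPz.
      destruct (excluded_middle_informative (forall x, cube B k z x -> cap Om i s x)) as [Hc|]; [|discriminate].
      split; auto. destruct (Hz z Hzl) as [_ [x [Hx [Hcx Hneg]]]]. exists x. split; auto.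
      intros HKx. apply (Rlt_not_le _ _ Hneg). apply Hst; auto. lra. }
    assert (H2 : INR (length (filter (fun z => negb (P z)) l)) <= theta / 2 * (2 ^ k) ^ N).
    { apply (Hslab k i lam s); [lia | apply NoDup_filter; auto | lra |]. intros z Hzin.
      apply filter_In in Hzin. destruct Hzin as [Hzl HPz]. unfold P in HPz.
      destruct (excluded_middle_informative (forall x, cube B k z x -> cap Om i s x)) as [|Hc]; [discriminate|].
      destruct (Hz z Hzl) as [Hcz _]. split.
      - intros x Hx. apply HMB. apply (Hcz x Hx).
      - apply not_all_ex_not in Hc. destruct Hc as [x Hx]. apply imply_to_and in Hx.
        destruct Hx as [Hx1 Hx2]. exists x. split; auto. destruct (Hcz x Hx1) as [Hox Hlx].
        split; [lra|]. apply Rnot_lt_le. intros Hlt. apply Hx2. split; auto. }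
    lra.
Qed.

(** [s] is the supremum of the bad positions, finite because caps are empty for large [lam]. Strict
    positivity at [s] clears a whole interval ending at [s], [s] included, so [s] would not be the
    least upper bound. *)
Lemma moving_planes {N} (Om : pt N -> Prop) f u D1 E C (i : Fin.t N) :
  solution Om f u D1 E C ->
  forall lam x, 0 < lam -> cap Om i lam x -> 0 <= refl_diff u i lam x.
Proof.
  intros HS. apply NNPP. intros HN.
  set (Bad := fun lam => 0 < lam /\ exists x, cap Om i lam x /\ refl_diff u i lam x < 0).
  assert (HBad : exists lam, Bad lam).
  { apply NNPP. intros HN2. apply HN. intros lam x Hl Hx. apply Rnot_lt_le. intros Hneg.
    apply HN2. exists lam. split; auto. exists x; auto. }
  destruct (sol_bounded _ _ _ _ _ _ HS) as [M HM].
  destruct (completeness Bad) as [s [Hs1 Hs2]]; auto.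
  { exists M. intros lam [Hl [x [[Hx1 Hx2] _]]]. specialize (HM x Hx1 i).
    pose proof (Rle_abs (x i)). lra. }
  assert (Hs : 0 < s).
  { destruct HBad as [lam Hlam]. specialize (Hs1 _ Hlam). destruct Hlam. lra. }
  assert (Hgood : forall mu y, s < mu -> cap Om i mu y -> 0 <= refl_diff u i mu y).
  { intros mu y Hmu Hy. apply Rnot_lt_le. intros Hneg.
    assert (mu <= s); [|lra]. apply Hs1. split; [lra|]. exists y; auto. }
  assert (Hpos := refl_diff_strictly_positive HS i s Hs
    (fun x Hx => refl_diff_right_limit HS i s x (Rlt_le _ _ Hs) Hx Hgood)).
  destruct (moving_planes_step Om f u D1 E C i s HS Hs Hpos) as [d [Hd Hstep]].
  assert (s <= s - d); [|lra].
  apply Hs2. intros lam Hlam. apply Rnot_lt_le. intros Hlt.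
  assert (Hle := Hs1 _ Hlam). destruct Hlam as [Hl [x [Hx Hneg]]].
  specialize (Hstep lam x Hl (conj Hlt Hle) Hx). lra.
Qed.

(** The limit [lam = 0] gives one inequality on [{x_i > 0}]; the opposite one is the same statement
    for the reflected solution. *)
Lemma solution_symmetric {N} (Om : pt N -> Prop) f u D1 E C (i : Fin.t N) x :
  solution Om f u D1 E C -> Om x -> u (refl i 0 x) = u x.
Proof.
  intros HS.
  assert (Hhalf : forall v F1 F2, solution Om f v F1 F2 C -> forall y, cap Om i 0 y -> v y <= v (refl i 0 y)).
  { intros v F1 F2 HV y Hy.
    pose proof (refl_diff_right_limit HV i 0 y (Rle_refl 0) Hy
      (fun mu y Hmu Hy => moving_planes Om f v F1 F2 C i HV mu y Hmu Hy)) as H.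
    unfold refl_diff in H. lra. }
  assert (HRR : forall x : pt N, refl i 0 (refl i 0 x) = x).
  { intros y. unfold refl. rewrite upd_upd, upd_same. rewrite <- (upd_id y i) at 3. f_equal. ring. }
  assert (Hcap : forall y, cap Om i 0 y -> u (refl i 0 y) = u y).
  { intros y Hy. apply Rle_antisym; [|apply (Hhalf _ _ _ HS); auto].
    pose proof (Hhalf _ _ _ (refl_solution Om f u D1 E C i HS) y Hy) as H. cbv beta in H.
    rewrite HRR in H. exact H. }
  intros Hx. destruct (Rtotal_order (x i) 0) as [Hlt|[Heq|Hgt]].
  - assert (Hc : cap Om i 0 (refl i 0 x)).
    { split; [|rewrite refl_same; lra]. apply (sol_mono _ _ _ _ _ _ HS x); auto. intros k.
      destruct (Fin.eq_dec i k) as [<-|Hk]; [|rewrite refl_other by auto; lra].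
      rewrite refl_same. replace (2 * 0 - x i) with (- x i) by ring. rewrite Rabs_Ropp. lra. }
    rewrite <- (HRR x) at 2. symmetry. apply Hcap. exact Hc.
  - unfold refl. replace (2 * 0 - x i) with (x i) by lra. rewrite upd_id. reflexivity.
  - apply Hcap. split; auto.
Qed.

(** * The Hessian at the origin *)

Lemma C1_lipschitz_on_segment f M :
  C1_R f -> 0 <= M ->
  exists C, 0 < C /\ forall a b, 0 <= a <= M -> 0 <= b <= M -> Rabs (f a - f b) <= C * Rabs (a - b).
Proof.
  intros [f' [Hf Hc]] HM.
  destruct (continuity_ab_maj (fun t => Rabs (f' t)) 0 M HM) as [m [Hm _]].
  { intros c _. apply (continuity_pt_comp f' Rabs); [apply Hc | apply Rcontinuity_abs]. }
  exists (Rabs (f' m) + 1). pose proof (Rabs_pos (f' m)). split; [lra|].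
  intros a b Ha Hb. destruct (MVT_gen f b a f') as [c [Hcb Heq]].
  - intros t _. apply is_derive_Reals, Hf.
  - intros t _. apply derivable_continuous_pt. exists (f' t). apply Hf.
  - rewrite Heq, Rabs_mult. apply Rmult_le_compat_r; [apply Rabs_pos|].
    specialize (Hm c). cbv beta in Hm.
    assert (0 <= c <= M); [|specialize (Hm ltac:(assumption)); lra].
    revert Hcb. unfold Rmin, Rmax. destruct (Rle_dec b a); lra.
Qed.

(** The reflected solution minus [u] vanishes along the line, and its derivative at [x] is
    [- 2 * D1 i x]. Having this on the whole hyperplane allows tangential differentiation. *)
Lemma normal_derivative_zero {N} (Om : pt N -> Prop) f u D1 E C (i : Fin.t N) x :
  solution Om f u D1 E C -> Om x -> x i = 0 -> D1 i x = 0.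
Proof.
  intros HS Hx Hxi.
  assert (Hrx : refl i 0 x = x).
  { unfold refl. replace (2 * 0 - x i) with (x i) by lra. apply upd_id. }
  destruct (sol_open _ _ _ _ _ _ HS x Hx) as [r [Hr Hball]].
  pose proof (sol_C2 _ _ _ _ _ _ (refl_solution Om f u D1 E C i HS)) as [H1 _].
  pose proof (sol_C2 _ _ _ _ _ _ HS) as [H2 _].
  specialize (H1 i x Hx). specialize (H2 i x Hx). rewrite Hrx in H1.
  pose proof (derivable_pt_lim_minus _ _ _ _ _ H1 H2) as H.
  apply (derivative_at_min _ _ _ r) in H; auto.
  - unfold refl_sign in H. destruct (Fin.eq_dec i i); [lra | contradiction].
  - intros s Hs. unfold minus_fct. rewrite upd_id, Hrx.
    rewrite (solution_symmetric Om f u D1 E C i (upd x i (x i + s)) HS); [lra|].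
    apply Hball, near_upd_self. replace (x i + s - x i) with s by ring. exact Hs.
Qed.

Lemma decreasing_point_on_axis {N} (Om : pt N -> Prop) f u D1 E C (i : Fin.t N) :
  solution Om f u D1 E C -> exists xi, 0 < xi /\ Om (upd origin i xi) /\ D1 i (upd origin i xi) < 0.
Proof.
  intros HS. destruct (axis_extent HS i) as [b [Hb [Hlt Hax]]].
  assert (Hbd := axis_end_boundary i b Hb Hlt Hax).
  assert (Hu0 := sol_pos _ _ _ _ _ _ HS _ (sol_origin _ _ _ _ _ _ HS)).
  destruct (sol_cont _ _ _ _ _ _ HS _ (proj1 Hbd) (u origin) Hu0) as [d [Hd Hc]].
  rewrite (sol_bd _ _ _ _ _ _ HS _ Hbd) in Hc.
  assert (He : 0 < Rmin d b) by (apply Rmin_pos; auto).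
  pose proof (Rmin_l d b). pose proof (Rmin_r d b).
  set (t1 := b - Rmin d b / 2).
  assert (Ht1 : 0 < t1 < b) by (unfold t1; lra).
  assert (Hu1 : u (upd origin i t1) < u origin).
  { assert (Hn : near (upd (@origin N) i b) (upd origin i t1) d).
    { apply near_upd; [apply near_refl; auto|]. apply Rabs_def1; unfold t1; lra. }
    assert (Hin : Om (upd origin i t1)) by (apply Hax; rewrite Rabs_right; lra).
    specialize (Hc _ (closure_incl _ _ Hin) Hn). apply Rabs_def2 in Hc. lra. }
  destruct (MVT_cor2 (fun t => u (upd origin i t)) (fun t => D1 i (upd origin i t)) 0 t1)
    as [xi [Hxi1 Hxi2]]; [lra| |].
  { intros c Hcc. apply has_partial_line. apply (sol_C2 _ _ _ _ _ _ HS). apply Hax.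
    rewrite Rabs_right; lra. }
  exists xi. split; [lra|]. split; [apply Hax; rewrite Rabs_right; lra|].
  replace (upd (@origin N) i 0) with (@origin N) in Hxi1 by (symmetry; apply (upd_id origin i)).
  nra.
Qed.

(* Where [D1 i] is bounded away from [0], [refl_diff u i lam] is at least [lam] times a constant;
   the tube barrier, whose rate does not depend on [lam], carries this bound to the axis. *)
Lemma refl_diff_axis_lower_bound {N} (Om : pt N -> Prop) f u D1 E C (i : Fin.t N) :
  solution Om f u D1 E C -> continuous_on Om (D1 i) ->
  exists kap l0, 0 < kap /\ 0 < l0 /\
    (forall t, Rabs t < 2 * l0 -> Om (upd origin i t)) /\
    forall lam s, 0 < lam < l0 -> 0 < s < l0 ->
      kap * lam * s <= u (upd origin i (lam - s)) - u (upd origin i (lam + s)).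
Proof.
  intros HS HD1.
  destruct (decreasing_point_on_axis Om f u D1 E C i HS) as [xi [Hxi [HP HDP]]].
  set (P := upd origin i xi) in *. set (a := - D1 i P / 2).
  destruct (sol_open _ _ _ _ _ _ HS P HP) as [r1 [Hr1 Hball1]].
  destruct (HD1 P HP a) as [r2 [Hr2 Hc2]]; [unfold a; lra|].
  set (r := Rmin r1 r2). assert (Hr : 0 < r) by (apply Rmin_pos; auto).
  assert (Hball : forall y, near P y r -> Om y /\ D1 i y < - a).
  { intros y Hy. assert (Hy1 : Om y) by (apply Hball1; eapply near_le; [exact Hy | apply Rmin_l]).
    split; auto. assert (Hn : near P y r2) by (eapply near_le; [exact Hy | apply Rmin_r]).
    specialize (Hc2 y Hy1 Hn). apply Rabs_def2 in Hc2. unfold a in *. lra. }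
  set (rho := r / 2). assert (Hrho : 0 < rho) by (unfold rho; lra).
  (* The corner with coordinate [xi] in direction [i] and [rho] elsewhere is in the ball around [P];
     monotonicity gives the box. *)
  assert (Hbox : forall x : pt N, (forall k, i <> k -> Rabs (x k) <= rho) -> Rabs (x i) <= xi -> Om x).
  { intros x Hx1 Hx2. apply (sol_mono _ _ _ _ _ _ HS (upd (fun _ => rho) i xi)).
    - apply Hball. intros k. unfold P, upd. destruct (Fin.eq_dec i k).
      + rewrite Rminus_diag, Rabs_R0. exact Hr.
      + unfold origin. rewrite Rminus_0_r, Rabs_right; unfold rho; lra.
    - intros k. unfold upd. destruct (Fin.eq_dec i k) as [<-|Hk].
      + rewrite (Rabs_right xi) by lra. exact Hx2.
      + rewrite (Rabs_right rho) by lra. auto. }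
  set (be := tube_rate N C rho).
  assert (Hbe : 0 < be) by (apply tube_rate_pos; auto; apply (sol_lip_pos _ _ _ _ _ _ HS)).
  assert (Ha : 0 < a) by (unfold a; lra).
  (* [2 * a] comes from the top of the tube, [be] from [exp (be * s) - 1 >= be * s], and the
     exponential bounds [exp (- (be * L))] from below for every [lam]. The quarter keeps
     [xi - 2 * lam] within [r] of [xi] and [s] below [L]. *)
  exists (2 * a * be * exp (- (be * xi))), (Rmin r xi / 4).
  assert (Hrx : 0 < Rmin r xi) by (apply Rmin_pos; auto).
  pose proof (Rmin_l r xi). pose proof (Rmin_r r xi).
  split.
  { repeat apply Rmult_lt_0_compat; try lra. apply exp_pos. }
  split; [lra|]. split.
  { intros t Ht. apply Hbox; [|rewrite upd_same; lra].
    intros k Hk. rewrite upd_other by auto. unfold origin. rewrite Rabs_R0. lra. }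
  intros lam s Hlam Hs.
  assert (Hl : 0 <= lam) by lra.
  set (L := xi - lam).
  assert (Htube : forall x, tube origin i 1 lam L rho x ->
    Om x /\ lam <= x i <= xi /\ forall k, i <> k -> Rabs (x k) <= rho).
  { intros x Hx.
    assert (Hk : forall k, i <> k -> Rabs (x k) <= rho).
    { intros k Hk. pose proof (tube_near origin i 1 lam L rho x k Hrho Hx Hk) as Hd.
      unfold origin in Hd. rewrite Rminus_0_r in Hd. exact Hd. }
    destruct Hx as [Hx _]. unfold L in Hx. split; [|split; [lra|auto]].
    apply Hbox; auto. apply Rabs_le. lra. }
  assert (Hcl : forall x, tube origin i 1 lam L rho x -> closure (cap Om i lam) x).
  { intros x Hx e He. destruct (Htube x Hx) as [Hox [Hxi' _]].
    destruct (sol_open _ _ _ _ _ _ HS x Hox) as [e' [He' Hb]].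
    pose proof (Rmin_l e e'). pose proof (Rmin_r e e').
    assert (0 < Rmin e e') by (apply Rmin_pos; auto).
    assert (Hn : near x (upd x i (x i + Rmin e e' / 2)) (Rmin e e')).
    { apply near_upd_self. replace (x i + Rmin e e' / 2 - x i) with (Rmin e e' / 2) by ring.
      rewrite Rabs_right; lra. }
    exists (upd x i (x i + Rmin e e' / 2)). split.
    - split; [apply Hb; eapply near_le; eauto|]. rewrite upd_same. lra.
    - eapply near_le; eauto. }
  assert (Hint : forall x, tube_int origin i 1 lam L rho x -> cap Om i lam x).
  { intros x [Hx1 Hx2]. split; [|lra]. apply Htube. split; lra. }
  assert (Hpos : forall x, tube origin i 1 lam L rho x -> 0 <= refl_diff u i lam x).
  { intros x Hx. destruct (classic (cap Om i lam x)) as [Hc|Hc].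
    - apply (moving_planes Om f u D1 E C i HS); auto. lra.
    - apply (refl_diff_boundary HS); auto. split; auto. }
  assert (Htop : forall x, tube origin i 1 lam L rho x -> 1 * (x i - lam) = L ->
    2 * lam * a <= refl_diff u i lam x).
  { intros x Hx Hxt. destruct (Htube x Hx) as [Hox [Hxr Hxk]].
    assert (Exi : x i = xi) by (unfold L in Hxt; lra).
    assert (Hnear : forall c, xi - 2 * lam <= c <= xi -> near P (upd x i c) r).
    { intros c Hcc k. unfold P, upd. destruct (Fin.eq_dec i k) as [<-|Hk].
      - apply Rabs_def1; lra.
      - specialize (Hxk k Hk). unfold origin. rewrite Rminus_0_r. unfold rho in *. lra. }
    (* Symmetry brings the reflected point back next to height [xi], where [D1 i < - a]. *)
    assert (Esym : u (refl i lam x) = u (upd x i (xi - 2 * lam))).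
    { rewrite <- (solution_symmetric Om f u D1 E C i (upd x i (xi - 2 * lam)) HS).
      - unfold refl. rewrite upd_upd, upd_same, Exi. f_equal. f_equal. ring.
      - apply Hball, Hnear. lra. }
    destruct (MVT_cor2 (fun t => u (upd x i t)) (fun t => D1 i (upd x i t)) (xi - 2 * lam) xi)
      as [c [Hc1 Hc2']]; [lra| |].
    { intros c Hcc. apply has_partial_line. apply (sol_C2 _ _ _ _ _ _ HS). apply Hball, Hnear, Hcc. }
    replace (upd x i xi) with x in Hc1 by (rewrite <- Exi, upd_id; reflexivity).
    assert (Hdc : D1 i (upd x i c) < - a) by (apply Hball, Hnear; lra).
    unfold refl_diff. rewrite Esym. nra. }
  pose proof (tube_lower_bound origin i 1 lam L rho C (2 * lam * a) (refl_diff u i lam)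
    (@refl_diff1 N D1 i lam) (@refl_diff2 N E i lam) ltac:(ring) Hrho (sol_lip_pos _ _ _ _ _ _ HS)
    ltac:(nra) (continuous_on_subset _ _ _ Hcl (refl_diff_continuous HS i lam Hl)) Hpos Htop
    (pure_C2_subset _ _ _ _ _ Hint (refl_diff_pure_C2 HS i lam Hl))) as T.
  assert (Hlap : forall x, tube_int origin i 1 lam L rho x ->
    sumF N (fun k => @refl_diff2 N E i lam k x) <= C * refl_diff u i lam x).
  { intros x Hx. pose proof (refl_diff_laplacian HS i lam x Hl (Hint x Hx)) as Hlp.
    rewrite Rabs_right in Hlp; auto. apply Rle_ge, Hpos.
    destruct Hx as [Hx1 Hx2]. split; lra. }
  specialize (T Hlap s ltac:(unfold L; lra)). fold be in T.
  unfold refl_diff, refl in T. rewrite upd_upd, upd_same in T.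
  replace (2 * lam - (lam + 1 * s)) with (lam - s) in T by ring.
  replace (lam + 1 * s) with (lam + s) in T by ring.
  eapply Rle_trans; [|exact T].
  assert (He1 : exp (- (be * xi)) <= exp (- (be * L))).
  { destruct (Rle_lt_or_eq_dec (- (be * xi)) (- (be * L))) as [Hlt|Heq].
    - unfold L. nra.
    - left. apply exp_increasing. exact Hlt.
    - rewrite Heq. lra. }
  assert (He2 : be * s <= exp (be * s) - 1).
  { assert (0 < be * s) by (apply Rmult_lt_0_compat; lra). pose proof (exp_ineq1 (be * s) ltac:(lra)). lra. }
  replace (2 * a * be * exp (- (be * xi)) * lam * s)
    with (2 * lam * a * exp (- (be * xi)) * (be * s)) by ring.
  pose proof (exp_pos (- (be * xi))).
  apply Rmult_le_compat; auto.
  - apply Rmult_le_pos; [nra|lra].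
  - apply Rmult_le_pos; lra.
  - apply Rmult_le_compat_l; [nra|exact He1].
Qed.

(** Both limits, [s -> 0] and then [lam -> 0], are right-sided minimum tests on functions that
    vanish at 0 and are nonnegative to its right. *)
Lemma second_derivative_at_origin_neg {N} (Om : pt N -> Prop) f u D1 E C (i : Fin.t N) :
  solution Om f u D1 E C -> continuous_on Om (D1 i) -> E i origin < 0.
Proof.
  intros HS HD1.
  destruct (refl_diff_axis_lower_bound Om f u D1 E C i HS HD1) as [kap [l0 [Hk [Hl0 [Hax Hlow]]]]].
  destruct (sol_C2 _ _ _ _ _ _ HS) as [H1 H2].
  assert (Hslope : forall lam, 0 < lam < l0 -> D1 i (upd origin i lam) <= - (kap * lam / 2)).
  { intros lam Hlam.
    assert (Hd : derivable_pt_lim (fun t => u (upd origin i t)) lam (D1 i (upd origin i lam))).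
    { apply has_partial_line, H1, Hax. rewrite Rabs_right; lra. }
    assert (Hd2 : derivable_pt_lim
      (fun s => u (upd origin i (lam - s)) - u (upd origin i (lam + s)) - kap * lam * s) 0
      (D1 i (upd origin i lam) * (0 - 1) - D1 i (upd origin i lam) * (0 + 1) - kap * lam * 1)).
    { apply (derivable_pt_lim_minus (fun s => u (upd origin i (lam - s)) - u (upd origin i (lam + s)))
        (fun s => kap * lam * s)).
      - apply (derivable_pt_lim_minus (fun s => u (upd origin i (lam - s)))
          (fun s => u (upd origin i (lam + s)))).
        + apply (derivable_pt_lim_comp (fun s => lam - s) (fun t => u (upd origin i t))).
          * apply (derivable_pt_lim_minus (fun _ => lam) (fun s => s));
              [apply derivable_pt_lim_const | apply derivable_pt_lim_id].
          * rewrite Rminus_0_r. exact Hd.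
        + apply (derivable_pt_lim_comp (fun s => lam + s) (fun t => u (upd origin i t))).
          * apply (derivable_pt_lim_plus (fun _ => lam) (fun s => s));
              [apply derivable_pt_lim_const | apply derivable_pt_lim_id].
          * rewrite Rplus_0_r. exact Hd.
      - apply (derivable_pt_lim_scal (fun s => s)). apply derivable_pt_lim_id. }
    apply (derivative_at_right_min_nonneg _ _ _ l0) in Hd2; [lra | auto |].
    intros s Hs. rewrite Rplus_0_l, Rminus_0_r, Rplus_0_r.
    specialize (Hlow lam s Hlam Hs). lra. }
  assert (H0 : upd (@origin N) i 0 = origin) by apply (upd_id origin i).
  assert (Hor := sol_origin _ _ _ _ _ _ HS).
  assert (Hz : D1 i origin = 0) by (apply (normal_derivative_zero Om f u D1 E C i origin HS); auto).
  assert (Hd : derivable_pt_lim (fun t => -1 * D1 i (upd origin i t) - kap / 2 * t) 0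
    (-1 * E i origin - kap / 2 * 1)).
  { apply (derivable_pt_lim_minus (fun t => -1 * D1 i (upd origin i t)) (fun t => kap / 2 * t)).
    - apply (derivable_pt_lim_scal (fun t => D1 i (upd origin i t))). apply (H2 i origin Hor).
    - apply (derivable_pt_lim_scal (fun t => t)). apply derivable_pt_lim_id. }
  apply (derivative_at_right_min_nonneg _ _ _ l0) in Hd; [lra | auto |].
  intros s Hs. rewrite Rplus_0_l, H0, Hz. specialize (Hslope s Hs). lra.
Qed.

(** [D1 j] vanishes on [{x_j = 0}], which contains the [x_i] axis. *)
Lemma mixed_derivative_at_origin_zero {N} (Om : pt N -> Prop) f u D1 E C (i j : Fin.t N) l :
  solution Om f u D1 E C -> i <> j -> has_partial (D1 j) i origin l -> l = 0.
Proof.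
  intros HS Hij Hl. destruct (axis_extent HS i) as [b [Hb [_ Hax]]].
  assert (Hz : forall t, Rabs t < b -> D1 j (upd origin i t) = 0).
  { intros t Ht. apply (normal_derivative_zero Om f u D1 E C j _ HS); auto.
    rewrite upd_other by auto. reflexivity. }
  apply (derivative_at_min _ _ _ b Hl Hb). intros s Hs.
  change (@origin N i) with 0. rewrite Rplus_0_l, !Hz; auto.
  - lra.
  - rewrite Rabs_R0. exact Hb.
Qed.

Theorem theorem2p1 (N : nat) (Omega : pt N -> Prop) (f : R -> R) (u : pt N -> R)
    (D1 : Fin.t N -> pt N -> R) (D2 : Fin.t N -> Fin.t N -> pt N -> R) :
  is_domain Omega -> is_bounded Omega ->
  (forall i, convex_in_dir Omega i) ->
  (forall i, symmetric_in_dir Omega i) ->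
  C1_R f ->
  C2_on Omega u D1 D2 ->
  continuous_on (closure Omega) u ->
  (forall x, Omega x -> - sumF N (fun i => D2 i i x) = f (u x)) ->
  (forall x, Omega x -> 0 < u x) ->
  (forall x, boundary Omega x -> u x = 0) ->
  (forall i j, i <> j -> D2 i j origin = 0) /\
  (forall xi : pt N, (exists i, xi i <> 0) ->
     sumF N (fun i => sumF N (fun j => xi i * D2 i j origin * xi j)) < 0).
Proof.
  intros [[x0 Hx0] [Hop _]] Hbd Hconv Hsym Hf [_ [HC1 [HcD1 [HC2 HcD2]]]] Hcont Heq Hpos Hbdu.
  assert (Hmono := convex_symmetric_monotone Omega Hconv Hsym).
  assert (Hsol : exists C, solution Omega f u D1 (fun k => D2 k k) C).
  (* The maximum of [u] supplies the compact interval on which [f] is Lipschitz. *)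
  { destruct (continuous_attains_min (closure Omega) (fun x => -1 * u x)) as [m [Hm Hmax]].
    - destruct Hbd as [M HM]. exists M. apply closure_bounded; auto.
    - apply closure_closed.
    - apply continuous_on_scal; auto.
    - exists x0. apply closure_incl; auto.
    - assert (Hu : forall x, Omega x -> 0 <= u x <= u m).
      { intros x Hx. specialize (Hmax x (closure_incl _ _ Hx)). cbv beta in Hmax.
        specialize (Hpos x Hx). lra. }
      destruct (C1_lipschitz_on_segment f (u m) Hf) as [C [HC Hlip]].
      { specialize (Hu x0 Hx0). lra. }
      exists C. constructor; auto.
      + apply (Hmono x0); auto. intros k. unfold origin. rewrite Rabs_R0. apply Rabs_pos.
      + split; auto. }
  destruct Hsol as [C HS].
  assert (Hor := sol_origin _ _ _ _ _ _ HS).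
  assert (Hoff : forall i j, i <> j -> D2 i j origin = 0).
  { intros i j Hij. apply (mixed_derivative_at_origin_zero Omega f u D1 _ C i j _ HS Hij).
    apply HC2, Hor. }
  split; auto. intros xi [i0 Hi0].
  assert (Hdiag : forall i, D2 i i origin < 0).
  { intros i. apply (second_derivative_at_origin_neg Omega f u D1 (fun k => D2 k k) C i HS). auto. }
  rewrite (sumF_ext N _ (fun i => -1 * (- D2 i i origin * (xi i)^2))).
  - rewrite sumF_scal.
    assert (Hge : - D2 i0 i0 origin * (xi i0)^2 <= sumF N (fun i => - D2 i i origin * (xi i)^2)).
    { apply (sumF_ge_term N (fun i => - D2 i i origin * (xi i)^2)). intros i.
      apply Rmult_le_pos; [specialize (Hdiag i); lra | apply pow2_ge_0]. }
    assert (0 < - D2 i0 i0 origin * (xi i0)^2); [|lra].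
    apply Rmult_lt_0_compat; [specialize (Hdiag i0); lra | apply pow2_gt_0; auto].
  - intros i. rewrite (sumF_only N _ i); [ring|].
    intros j Hij. rewrite Hoff by auto. ring.
Qed.
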